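(* Let $\sigma = 2\sqrt{2}\,\pi$ and, for a positive integer $N_1$, let $p_j = -\exp\!\big(-\sigma(\sqrt{N_1}-\sqrt{j}\,)\big)$, $1\le j\le N_1$. Assume the following bound holds for all sufficiently large positive integers $N_t$, with $h=2\pi^2$ and $T=\sqrt{N_t h/4}$: for every $x\in[e^{4-2T},1]$, $$\left|\int_\Gamma f(u,x)\,\delta(u)\,du\right| < 12\, e^{-T},$$ with $f,\delta,\Gamma$ as in the context. Then there exist coefficients $a_1,\dots,a_{N_1}$ and a polynomial $b$ of degree $N_2=\mathcal{O}(\sqrt{N_1}\,)$ such that, with $N=N_1+N_2$, the rational function $r(x)=\sum_{j=1}^{N_1}\frac{a_j}{x-p_j}+b(x)$ satisfies $$|r(x)-\sqrt{x}\,| = \mathcal{O}\big(e^{-\pi\sqrt{2N}}\big)$$ as $N\to\infty$, uniformly for $x\in[0,1]$.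
   Context: Here $\sqrt{u}$ denotes the principal branch of the square root. For $u\in\mathbb{C}$ and $x\in(0,1]$, $f(u,x) = \frac{x}{\pi}\,\frac{1}{\sqrt{u}}\,\frac{e^{\sqrt{u}-T}}{e^{2(\sqrt{u}-T)}+x}$. The function $\delta(u)=\mu(u)-m(u)$, where $\mu(u)=-\tfrac12$ if $\operatorname{Im}u\ge 0$ and $\mu(u)=\tfrac12$ if $\operatorname{Im}u<0$, and $m(u) = -\tfrac{i}{2}\cot(\pi u/h)$. The contour $\Gamma$ is the positively oriented boundary of the rectangle $\{u: 1\le \operatorname{Re}u\le 4T^2+1,\ |\operatorname{Im}u|\le a\}$ with $a = 2\pi(T+\tfrac12\log x)$. *)

(* Defs.v *)
From Stdlib Require Export Reals.
From Coquelicot Require Export Coquelicot.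
Open Scope R_scope.

Definition cexp (z : C) : C := (exp (Re z) * cos (Im z), exp (Re z) * sin (Im z)).
Definition csin (z : C) : C := ((cexp (Ci * z) - cexp (- (Ci * z))) / (2 * Ci))%C.
Definition ccos (z : C) : C := ((cexp (Ci * z) + cexp (- (Ci * z))) / 2)%C.
Definition ccot (z : C) : C := (ccos z / csin z)%C.

(* principal branch of the square root (argument in (-pi, pi], branch cut on
   the negative real axis, where the value is i*sqrt|z|) *)
Definition csqrt (z : C) : C :=
  (sqrt ((Cmod z + Re z) / 2),
   if Rle_dec 0 (Im z) then sqrt ((Cmod z - Re z) / 2)
   else - sqrt ((Cmod z - Re z) / 2)).

Definition f_fun (T : R) (u : C) (x : R) : C :=
  (RtoC (x / PI) * / csqrt u * cexp (csqrt u - RtoC T)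
     / (cexp (2 * (csqrt u - RtoC T)) + RtoC x))%C.

Definition mu (u : C) : C := if Rle_dec 0 (Im u) then RtoC (-1/2) else RtoC (1/2).
Definition m_fun (h : R) (u : C) : C := (- (Ci / 2) * ccot (RtoC PI * u / RtoC h))%C.
Definition delta (h : R) (u : C) : C := (mu u - m_fun h u)%C.

(* complex line integral of g over the positively oriented boundary of the
   rectangle { u : x0 <= Re u <= x1, |Im u| <= a }, as the sum of the four
   parametrized sides (bottom, right, top, left) *)
Definition rect_contour_integral (g : C -> C) (x0 x1 a : R) : C :=
  (@RInt C_R_CompleteNormedModule (fun t => g (t, (- a)%R)) x0 x1
   + Ci * @RInt C_R_CompleteNormedModule (fun s => g (x1, s)) (- a)%R a
   - @RInt C_R_CompleteNormedModule (fun t => g (t, a)) x0 x1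
   - Ci * @RInt C_R_CompleteNormedModule (fun s => g (x0, s)) (- a)%R a)%C.

Definition Gamma_integral (T h x : R) : C :=
  rect_contour_integral (fun u => (f_fun T u x * delta h u)%C)
    1 (4 * T ^ 2 + 1) (2 * PI * (T + / 2 * ln x)).

Fixpoint sum_1_to (n : nat) (g : nat -> R) : R :=
  match n with O => 0 | S m => sum_1_to m g + g (S m) end.

Definition sigma : R := 2 * sqrt 2 * PI.
Definition pole (N1 j : nat) : R := - exp (- sigma * (sqrt (INR N1) - sqrt (INR j))).

Definition r_fun (N1 N2 : nat) (a c : nat -> R) (x : R) : R :=
  sum_1_to N1 (fun j => a j / (x - pole N1 j)) + sum_f_R0 (fun k => c k * x ^ k) N2.

(* Main.v *)
(** Substituting [s = exp (sqrt u - T)] in [sqrt x = (2 x / pi) int_0^oo ds / (s^2 + x)]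
    writes [sqrt x] as the integral of [f(u, x)] over [u > 0], and the part outside
    [1 <= u <= 4 T^2 + 1] is [O(e^-T)].  The residue theorem on the rectangle bounded by Gamma
    expresses the difference between this integral and the trapezoidal sum
    [S(x) = h sum_j f(j h, x)], [1 <= j <= Nt], as the integral of [f delta] over Gamma, which is
    [O(e^-T)] by hypothesis, minus the contributions of the two poles of [f] inside Gamma, where
    [delta] is [O(e^-T / sqrt x)] and the residue is [O(sqrt x)].  For [x < e^(4 - 2T)] both
    [S(x)] and [sqrt x] are [O(e^-T)] directly.  Take [Nt = 4 N1].  The terms [j <= N1] of [S]
    have exactly the prescribed poles; the other terms have their poles in [(-oo, -1]], so
    Taylor polynomials at [1/2] of degree [O(sqrt N1)] approximate them with ratio [1/3].
    Finally [N2 = O(sqrt N1)] changes [sqrt (2 N)] only by [O(1)]. *)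

Require Import Defs.
From Stdlib Require Import Reals Arith ZArith Lra Lia Psatz.
From Coquelicot Require Import Coquelicot.
Open Scope R_scope.

(** * Complex differentiability and integrals along rectangles *)

(** [mu] jumps across the real axis and [m] has its poles there, so [f * delta] is never treated as
    a whole. The [mu] part is split along the axis into two half rectangles with one pole of [f]
    each; closing them up produces the integral of [f] over the axis. The [m] part is cut at half
    the height of the poles of [f]: the low strip contains only the nodes, each outer piece only one
    pole of [f]. The constants fit as follows. With [L = flen T x], the two poles of [f] have height
    [PI * L] up to sign and residue of modulus [sqrt x / PI], where [sqrt x = exp (L - T)]. There
    [delta] is of order [exp (- 2 * PI * (PI * L) / h)], and [h = 2 * PI ^ 2] turns this into
    [exp (- L)], so the product is of order [exp (- T)] uniformly in [x]. The condition
    [exp (4 - 2 * T) <= x] says [2 <= L], which places these poles to the right of the line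
    [Re u = 1]. With [Nt = 4 * N1], [T] is the value of [sqrt u] at node [N1], so the term of that
    node has its pole at [x = -1]. *)

Definition near (z : C) (P : C -> Prop) : Prop :=
  exists r, 0 < r /\ forall w, Cmod (w - z) < r -> P w.

Lemma near_and (z : C) (P Q : C -> Prop) :
  near z P -> near z Q -> near z (fun w => P w /\ Q w).
Proof.
  intros [r [Hr HP]] [s [Hs HQ]]. exists (Rmin r s). split.
  - apply Rmin_pos; assumption.
  - intros w Hw. pose proof (Rmin_l r s). pose proof (Rmin_r r s).
    split; [apply HP | apply HQ]; lra.
Qed.

Lemma near_mono (z : C) (P Q : C -> Prop) :
  (forall w, P w -> Q w) -> near z P -> near z Q.
Proof. intros H [r [Hr HP]]. exists r. split; auto. Qed.

Lemma near_self (z : C) (P : C -> Prop) : near z P -> P z.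
Proof.
  intros [r [Hr HP]]. apply HP. replace (z - z)%C with (RtoC 0) by ring.
  rewrite Cmod_0. exact Hr.
Qed.

Definition ccont (F : C -> C) (z : C) : Prop :=
  forall eps, 0 < eps -> near z (fun w => Cmod (F w - F z) < eps).

Lemma ccont_const (k z : C) : ccont (fun _ => k) z.
Proof.
  intros e He. exists 1. split; [lra|]. intros w _.
  replace (k - k)%C with (RtoC 0) by ring. rewrite Cmod_0. exact He.
Qed.

Lemma ccont_id (z : C) : ccont (fun w => w) z.
Proof. intros e He. exists e. split; auto. Qed.

Lemma ccont_plus (F G : C -> C) (z : C) :
  ccont F z -> ccont G z -> ccont (fun w => F w + G w)%C z.
Proof.
  intros HF HG e He.
  assert (He2 : 0 < e / 2) by lra.
  refine (near_mono _ _ _ _ (near_and _ _ _ (HF _ He2) (HG _ He2))).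
  intros w [H1 H2].
  replace (F w + G w - (F z + G z))%C with ((F w - F z) + (G w - G z))%C by ring.
  eapply Rle_lt_trans; [apply Cmod_triangle | lra].
Qed.

Lemma ccont_mult (F G : C -> C) (z : C) :
  ccont F z -> ccont G z -> ccont (fun w => F w * G w)%C z.
Proof.
  intros HF HG e He.
  set (A := Cmod (F z)). set (B := Cmod (G z)).
  assert (HA : 0 <= A) by apply Cmod_ge_0.
  assert (HB : 0 <= B) by apply Cmod_ge_0.
  (* Taking [d <= 1] lets the product of the two increments count as one more linear term, so the
     total is below [d * (A + B + 1)]. *)
  set (d := Rmin 1 (e / (A + B + 2))).
  assert (Hd : 0 < d) by (apply Rmin_pos; [lra | apply Rdiv_lt_0_compat; lra]).
  assert (Hd1 : d <= 1) by apply Rmin_l.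
  assert (Hd2 : d * (A + B + 2) <= e).
  { apply Rle_trans with (e / (A + B + 2) * (A + B + 2)).
    - apply Rmult_le_compat_r; [lra | apply Rmin_r].
    - right. field. lra. }
  refine (near_mono _ _ _ _ (near_and _ _ _ (HF _ Hd) (HG _ Hd))).
  intros w [H1 H2].
  replace (F w * G w - F z * G z)%C
    with ((F w - F z) * (G w - G z) + F z * (G w - G z) + (F w - F z) * G z)%C by ring.
  eapply Rle_lt_trans; [apply Cmod_triangle|].
  eapply Rle_lt_trans; [apply Rplus_le_compat_r, Cmod_triangle|].
  rewrite !Cmod_mult. fold A B.
  pose proof (Cmod_ge_0 (F w - F z)). pose proof (Cmod_ge_0 (G w - G z)).
  nra.
Qed.

Lemma ccont_comp (F G : C -> C) (z : C) :
  ccont G z -> ccont F (G z) -> ccont (fun w => F (G w)) z.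
Proof.
  intros HG HF e He. destruct (HF e He) as [r [Hr H]].
  refine (near_mono _ _ _ _ (HG r Hr)). intros w Hw. apply H, Hw.
Qed.

Lemma ccont_neq0 (F : C -> C) (z : C) :
  ccont F z -> F z <> RtoC 0 -> near z (fun w => Cmod (F z) / 2 < Cmod (F w)).
Proof.
  intros HF Hz. assert (H0 : 0 < Cmod (F z)) by (apply Cmod_gt_0; exact Hz).
  assert (H1 : 0 < Cmod (F z) / 2) by lra.
  refine (near_mono _ _ _ _ (HF _ H1)). intros w Hw.
  pose proof (Cmod_triangle (F w) (- (F w - F z))) as H.
  rewrite Cmod_opp in H.
  replace (F w + - (F w - F z))%C with (F z) in H by ring. lra.
Qed.

Lemma ccont_inv (F : C -> C) (z : C) :
  ccont F z -> F z <> RtoC 0 -> ccont (fun w => / F w)%C z.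
Proof.
  intros HF Hz e He.
  assert (H0 : 0 < Cmod (F z)) by (apply Cmod_gt_0; exact Hz).
  set (A := Cmod (F z)) in *.
  assert (Hd : 0 < e * A * A / 2) by (apply Rdiv_lt_0_compat; [repeat apply Rmult_lt_0_compat; assumption | lra]).
  refine (near_mono _ _ _ _ (near_and _ _ _ (HF _ Hd) (ccont_neq0 _ _ HF Hz))).
  intros w [H1 H2]. fold A in H2.
  assert (Hw : F w <> RtoC 0) by (apply Cmod_gt_0; lra).
  replace (/ F w - / F z)%C with (- (F w - F z) * / (F w * F z))%C
    by (field; split; assumption).
  rewrite Cmod_mult, Cmod_opp, Cmod_inv, Cmod_mult by (apply Cmult_neq_0; assumption).
  fold A.
  assert (H3 : 0 < Cmod (F w) * A) by nra.
  apply Rmult_lt_reg_r with (Cmod (F w) * A); [exact H3|].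
  rewrite Rmult_assoc, Rinv_l, Rmult_1_r by lra. nra.
Qed.

Lemma ccont_near_ext (F G : C -> C) (z : C) :
  near z (fun w => F w = G w) -> ccont F z -> ccont G z.
Proof.
  intros H HF e He. pose proof (near_self _ _ H) as Hz. simpl in Hz.
  refine (near_mono _ _ _ _ (near_and _ _ _ H (HF e He))).
  intros w [H1 H2]. rewrite <- H1, <- Hz. exact H2.
Qed.

(* Caratheodory's form of differentiability: the difference quotient extends
   continuously to [z]; it reduces the calculus rules to continuity. *)
Definition cdiff (F : C -> C) (z d : C) : Prop :=
  exists q : C -> C, ccont q z /\ q z = d /\
    near z (fun w => F w = F z + q w * (w - z))%C.

Lemma cdiff_ccont (F : C -> C) (z d : C) : cdiff F z d -> ccont F z.
Proof.
  intros [q [Hq [_ H]]].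
  apply (ccont_near_ext (fun w => F z + q w * (w - z))%C).
  - refine (near_mono _ _ _ _ H). intros w Hw. symmetry. exact Hw.
  - apply ccont_plus; [apply ccont_const|]. apply ccont_mult; [exact Hq|].
    apply ccont_plus; [apply ccont_id | apply ccont_const].
Qed.

Lemma cdiff_const (k z : C) : cdiff (fun _ => k) z 0.
Proof.
  exists (fun _ => RtoC 0). split; [apply ccont_const|]. split; [reflexivity|].
  exists 1. split; [lra|]. intros. ring.
Qed.

Lemma cdiff_id (z : C) : cdiff (fun w => w) z 1.
Proof.
  exists (fun _ => RtoC 1). split; [apply ccont_const|]. split; [reflexivity|].
  exists 1. split; [lra|]. intros. ring.
Qed.

Lemma cdiff_plus (F G : C -> C) (z d e : C) :
  cdiff F z d -> cdiff G z e -> cdiff (fun w => F w + G w)%C z (d + e)%C.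
Proof.
  intros [p [Hp [Ep HF]]] [q [Hq [Eq HG]]].
  exists (fun w => p w + q w)%C. split; [apply ccont_plus; assumption|].
  split; [rewrite Ep, Eq; reflexivity|].
  refine (near_mono _ _ _ _ (near_and _ _ _ HF HG)).
  intros w [H1 H2]. rewrite H1, H2. ring.
Qed.

Lemma cdiff_mult (F G : C -> C) (z d e : C) :
  cdiff F z d -> cdiff G z e ->
  cdiff (fun w => F w * G w)%C z (d * G z + F z * e)%C.
Proof.
  intros HF0 HG0. pose proof (cdiff_ccont _ _ _ HG0) as HGc.
  destruct HF0 as [p [Hp [Ep HF]]]. destruct HG0 as [q [Hq [Eq HG]]].
  exists (fun w => p w * G w + F z * q w)%C. split.
  { apply ccont_plus; apply ccont_mult; try assumption. apply ccont_const. }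
  split; [rewrite Ep, Eq; reflexivity|].
  refine (near_mono _ _ _ _ (near_and _ _ _ HF HG)).
  intros w [H1 H2]. rewrite H1.
  (* The added multiple of [F z] vanishes by the expansion of [G] at [z]; with it present, the other
     side is a ring identity in which [G w] stays opaque. *)
  transitivity ((F z + p w * (w - z)) * G w + F z * (G z - G w + q w * (w - z)))%C.
  - rewrite H2. ring.
  - ring.
Qed.

Lemma cdiff_inv (F : C -> C) (z d : C) :
  cdiff F z d -> F z <> RtoC 0 ->
  cdiff (fun w => / F w)%C z (- d / (F z * F z))%C.
Proof.
  intros HF0 Hz. pose proof (cdiff_ccont _ _ _ HF0) as Hc.
  pose proof (ccont_neq0 _ _ Hc Hz) as Hn.
  destruct HF0 as [p [Hp [Ep HF]]].
  exists (fun w => - (1) * p w * / (F w * F z))%C. split.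
  { apply ccont_mult.
    - apply ccont_mult; [apply ccont_const | exact Hp].
    - apply ccont_inv; [|apply Cmult_neq_0; assumption].
      apply ccont_mult; [exact Hc | apply ccont_const]. }
  split; [rewrite Ep; field; assumption|].
  refine (near_mono _ _ _ _ (near_and _ _ _ HF Hn)).
  intros w [H1 H2].
  assert (Hw : F w <> RtoC 0) by (apply Cmod_gt_0; pose proof (Cmod_ge_0 (F z)); lra).
  assert (H3 : (p w * (w - z) = F w - F z)%C) by (rewrite H1; ring).
  transitivity (/ F z + - (p w * (w - z)) * / (F w * F z))%C.
  - rewrite H3. field. split; assumption.
  - ring.
Qed.

Lemma cdiff_comp (F G : C -> C) (z d e : C) :
  cdiff G z e -> cdiff F (G z) d -> cdiff (fun w => F (G w)) z (d * e)%C.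
Proof.
  intros HG0 HF0. pose proof (cdiff_ccont _ _ _ HG0) as HGc.
  destruct HG0 as [q [Hq [Eq HG]]]. destruct HF0 as [p [Hp [Ep [r [Hr HF]]]]].
  exists (fun w => p (G w) * q w)%C. split.
  { apply ccont_mult; [|exact Hq]. apply (ccont_comp p G); assumption. }
  split; [rewrite Ep, Eq; reflexivity|].
  refine (near_mono _ _ _ _ (near_and _ _ _ HG (HGc r Hr))).
  intros w [H1 H2]. rewrite (HF (G w)) by exact H2.
  rewrite H1 at 2. ring.
Qed.

Lemma cdiff_eq (F : C -> C) (z d e : C) : d = e -> cdiff F z d -> cdiff F z e.
Proof. intros ->. auto. Qed.

Definition holo (F : C -> C) (z : C) : Prop := exists d, cdiff F z d.

Lemma holo_ccont (F : C -> C) (z : C) : holo F z -> ccont F z.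
Proof. intros [d H]. exact (cdiff_ccont _ _ _ H). Qed.

Lemma holo_const (k z : C) : holo (fun _ => k) z.
Proof. eexists. apply cdiff_const. Qed.

Lemma holo_mult (F G : C -> C) (z : C) :
  holo F z -> holo G z -> holo (fun w => F w * G w)%C z.
Proof. intros [d H] [e H']. eexists. apply cdiff_mult; eassumption. Qed.

Lemma holo_plus (F G : C -> C) (z : C) :
  holo F z -> holo G z -> holo (fun w => F w + G w)%C z.
Proof. intros [d H] [e H']. eexists. apply cdiff_plus; eassumption. Qed.

Lemma holo_inv (F : C -> C) (z : C) :
  holo F z -> F z <> RtoC 0 -> holo (fun w => / F w)%C z.
Proof. intros [d H] H'. eexists. apply cdiff_inv; eassumption. Qed.

Lemma holo_comp (F G : C -> C) (z : C) :
  holo G z -> holo F (G z) -> holo (fun w => F (G w)) z.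
Proof. intros [d H] [e H']. eexists. apply cdiff_comp; eassumption. Qed.

(** * Integrals of complex functions over intervals and rectangle boundaries *)

Definition CInt (g : R -> C) (a b : R) : C := @RInt C_R_CompleteNormedModule g a b.
Definition is_CInt (g : R -> C) (a b : R) (l : C) : Prop := @is_RInt C_R_NormedModule g a b l.
Definition ex_CInt (g : R -> C) (a b : R) : Prop := @ex_RInt C_R_NormedModule g a b.

Lemma is_CInt_unique (g : R -> C) (a b : R) (l : C) : is_CInt g a b l -> CInt g a b = l.
Proof. apply (@is_RInt_unique C_R_CompleteNormedModule). Qed.

Lemma CInt_correct (g : R -> C) (a b : R) : ex_CInt g a b -> is_CInt g a b (CInt g a b).
Proof. apply (@RInt_correct C_R_CompleteNormedModule). Qed.

Lemma is_CInt_pair (g : R -> C) (a b l1 l2 : R) :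
  is_RInt (fun t => fst (g t)) a b l1 -> is_RInt (fun t => snd (g t)) a b l2 ->
  is_CInt g a b (l1, l2).
Proof. apply (@is_RInt_fct_extend_pair R_NormedModule R_NormedModule). Qed.

Lemma is_CInt_fst (g : R -> C) (a b : R) (l : C) :
  is_CInt g a b l -> is_RInt (fun t => fst (g t)) a b (fst l).
Proof. apply (@is_RInt_fct_extend_fst R_NormedModule R_NormedModule). Qed.

Lemma is_CInt_snd (g : R -> C) (a b : R) (l : C) :
  is_CInt g a b l -> is_RInt (fun t => snd (g t)) a b (snd l).
Proof. apply (@is_RInt_fct_extend_snd R_NormedModule R_NormedModule). Qed.

Lemma is_CInt_plus (f g : R -> C) (a b : R) (k l : C) :
  is_CInt f a b k -> is_CInt g a b l -> is_CInt (fun t => f t + g t)%C a b (k + l)%C.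
Proof. apply (@is_RInt_plus C_R_NormedModule). Qed.

(** The integral lives in a normed module over the reals, so a complex factor is treated on real and
    imaginary parts. *)
Lemma is_CInt_mult (k : C) (g : R -> C) (a b : R) (l : C) :
  is_CInt g a b l -> is_CInt (fun t => k * g t)%C a b (k * l)%C.
Proof.
  intros H. pose proof (is_CInt_fst _ _ _ _ H) as H1.
  pose proof (is_CInt_snd _ _ _ _ H) as H2.
  apply is_CInt_pair; simpl.
  - apply (is_RInt_minus (V := R_NormedModule));
      apply (is_RInt_scal (V := R_NormedModule)); assumption.
  - apply (is_RInt_plus (V := R_NormedModule));
      apply (is_RInt_scal (V := R_NormedModule)); assumption.
Qed.

Lemma is_CInt_ext (f g : R -> C) (a b : R) (l : C) :
  (forall t, Rmin a b < t < Rmax a b -> f t = g t) -> is_CInt f a b l -> is_CInt g a b l.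
Proof. apply (@is_RInt_ext C_R_NormedModule). Qed.

Lemma is_CInt_Chasles (g : R -> C) (a b c : R) (k l : C) :
  is_CInt g a b k -> is_CInt g b c l -> is_CInt g a c (k + l)%C.
Proof. apply (@is_RInt_Chasles C_R_NormedModule). Qed.

Lemma is_CInt_le (g : R -> C) (a b M : R) (l : C) :
  a <= b -> (forall t, a <= t <= b -> Cmod (g t) <= M) -> is_CInt g a b l ->
  Cmod l <= (b - a) * M.
Proof.
  intros Hab Hg H.
  assert (HN : forall z : C, @norm _ C_R_NormedModule z = Cmod z).
  { intros z. unfold Cmod. cbn. unfold prod_norm. cbn. unfold abs. cbn.
    f_equal. rewrite !Rmult_1_r, <- !Rabs_mult, !Rabs_pos_eq by nra. reflexivity. }
  rewrite <- HN, <- (Rabs_pos_eq (b - a)) by lra.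
  apply (@norm_RInt_le_const_abs C_R_NormedModule g a b l M); [|exact H].
  intros t. rewrite Rmin_left, Rmax_right by lra. intros Ht. rewrite HN. apply Hg, Ht.
Qed.

(** Stated for curves that do not increase distances, so that horizontal and vertical sides are both
    instances. *)
Lemma ccont_curve_continuous (F : C -> C) (p : R -> C) (t : R) :
  (forall s, Cmod (p s - p t) <= Rabs (s - t)) -> ccont F (p t) ->
  @continuous R_UniformSpace C_R_CompleteNormedModule (fun s => F (p s)) t.
Proof.
  intros Hp HF. apply filterlim_locally. intros eps.
  destruct (HF eps (cond_pos eps)) as [r [Hr H]].
  exists (mkposreal r Hr). intros s Hs.
  assert (Hd : Cmod (F (p s) - F (p t)) < eps).
  { apply H. eapply Rle_lt_trans; [apply Hp|]. exact Hs. }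
  pose proof (Rmax_Cmod (F (p s) - F (p t))%C) as HM.
  split.
  - eapply Rle_lt_trans; [|exact Hd]. eapply Rle_trans; [apply Rmax_l | exact HM].
  - eapply Rle_lt_trans; [|exact Hd]. eapply Rle_trans; [apply Rmax_r | exact HM].
Qed.

Lemma Cmod_re (a : R) : Cmod (a, 0) = Rabs a.
Proof. exact (Cmod_R a). Qed.

Lemma Cmod_im (a : R) : Cmod (0, a) = Rabs a.
Proof. unfold Cmod. simpl. rewrite <- sqrt_Rsqr_abs. f_equal. unfold Rsqr. ring. Qed.

Lemma ex_CInt_h (F : C -> C) (a b y : R) :
  a <= b -> (forall t, a <= t <= b -> ccont F (t, y)) -> ex_CInt (fun t => F (t, y)) a b.
Proof.
  intros Hab H. apply (@ex_RInt_continuous C_R_CompleteNormedModule).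
  intros t. rewrite Rmin_left, Rmax_right by lra. intros Ht.
  apply (ccont_curve_continuous F (fun t => (t, y))); [|apply H, Ht].
  intros s. right. rewrite <- Cmod_re. f_equal. unfold Cminus, Cplus, Copp. simpl.
  f_equal; ring.
Qed.

Lemma ex_CInt_v (F : C -> C) (a b x : R) :
  a <= b -> (forall t, a <= t <= b -> ccont F (x, t)) -> ex_CInt (fun t => F (x, t)) a b.
Proof.
  intros Hab H. apply (@ex_RInt_continuous C_R_CompleteNormedModule).
  intros t. rewrite Rmin_left, Rmax_right by lra. intros Ht.
  apply (ccont_curve_continuous F (fun t => (x, t))); [|apply H, Ht].
  intros s. right. rewrite <- Cmod_im. f_equal. unfold Cminus, Cplus, Copp. simpl.
  f_equal; ring.
Qed.

(** The four sides of [rect_contour_integral], with independent lower and upper bounds so that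
    rectangles can be cut in both directions. With bounds [- a] and [a] the two are convertible. *)
Definition rect_int (g : C -> C) (x0 x1 y0 y1 : R) : C :=
  (CInt (fun t => g (t, y0)) x0 x1 + Ci * CInt (fun s => g (x1, s)) y0 y1
   - CInt (fun t => g (t, y1)) x0 x1 - Ci * CInt (fun s => g (x0, s)) y0 y1)%C.

Definition rect_boundary (x0 x1 y0 y1 : R) (z : C) : Prop :=
  x0 <= fst z <= x1 /\ y0 <= snd z <= y1 /\
  (fst z = x0 \/ fst z = x1 \/ snd z = y0 \/ snd z = y1).

Lemma CInt_Chasles (g : R -> C) (a b c : R) :
  ex_CInt g a b -> ex_CInt g b c -> (CInt g a b + CInt g b c = CInt g a c)%C.
Proof. apply (@RInt_Chasles C_R_CompleteNormedModule). Qed.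

(** The cut enters the two pieces with opposite signs and cancels as one and the same term;
    continuity serves to divide the horizontal integrals. *)
Lemma rect_int_split_x (g : C -> C) (x0 m x1 y0 y1 : R) :
  x0 <= m <= x1 -> y0 <= y1 ->
  (forall t, x0 <= t <= x1 -> ccont g (t, y0)) ->
  (forall t, x0 <= t <= x1 -> ccont g (t, y1)) ->
  rect_int g x0 x1 y0 y1 = (rect_int g x0 m y0 y1 + rect_int g m x1 y0 y1)%C.
Proof.
  intros Hm Hy H0 H1. unfold rect_int.
  rewrite <- (CInt_Chasles (fun t => g (t, y0)) x0 m x1);
    [|apply ex_CInt_h; [lra|]; intros; apply H0; lra..].
  rewrite <- (CInt_Chasles (fun t => g (t, y1)) x0 m x1);
    [|apply ex_CInt_h; [lra|]; intros; apply H1; lra..].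
  ring.
Qed.

Lemma rect_int_split_y (g : C -> C) (x0 x1 y0 m y1 : R) :
  x0 <= x1 -> y0 <= m <= y1 ->
  (forall t, y0 <= t <= y1 -> ccont g (x0, t)) ->
  (forall t, y0 <= t <= y1 -> ccont g (x1, t)) ->
  rect_int g x0 x1 y0 y1 = (rect_int g x0 x1 y0 m + rect_int g x0 x1 m y1)%C.
Proof.
  intros Hm Hy H0 H1. unfold rect_int.
  rewrite <- (CInt_Chasles (fun t => g (x0, t)) y0 m y1);
    [|apply ex_CInt_v; [lra|]; intros; apply H0; lra..].
  rewrite <- (CInt_Chasles (fun t => g (x1, t)) y0 m y1);
    [|apply ex_CInt_v; [lra|]; intros; apply H1; lra..].
  ring.
Qed.

Lemma rect_int_lin (k l : C) (f g : C -> C) (x0 x1 y0 y1 : R) :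
  x0 <= x1 -> y0 <= y1 ->
  (forall z, rect_boundary x0 x1 y0 y1 z -> ccont f z) -> (forall z, rect_boundary x0 x1 y0 y1 z -> ccont g z) ->
  rect_int (fun z => k * f z + l * g z)%C x0 x1 y0 y1
  = (k * rect_int f x0 x1 y0 y1 + l * rect_int g x0 x1 y0 y1)%C.
Proof.
  intros Hx Hy Hf Hg. unfold rect_int.
  assert (E : forall p : R -> C, forall a b, ex_CInt (fun t => f (p t)) a b ->
     ex_CInt (fun t => g (p t)) a b ->
     (CInt (fun t => k * f (p t) + l * g (p t)) a b
     = k * CInt (fun t => f (p t)) a b + l * CInt (fun t => g (p t)) a b)%C).
  { intros p a b H1 H2. apply is_CInt_unique, is_CInt_plus;
    apply is_CInt_mult, CInt_correct; assumption. }
  rewrite (E (fun t => (t, y0))), (E (fun t => (t, y1))), (E (fun t => (x0, t))),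
    (E (fun t => (x1, t))).
  - ring.
  - apply ex_CInt_v; [lra|]. intros. apply Hf. unfold rect_boundary; simpl; lra.
  - apply ex_CInt_v; [lra|]. intros. apply Hg. unfold rect_boundary; simpl; lra.
  - apply ex_CInt_v; [lra|]. intros. apply Hf. unfold rect_boundary; simpl; lra.
  - apply ex_CInt_v; [lra|]. intros. apply Hg. unfold rect_boundary; simpl; lra.
  - apply ex_CInt_h; [lra|]. intros. apply Hf. unfold rect_boundary; simpl; lra.
  - apply ex_CInt_h; [lra|]. intros. apply Hg. unfold rect_boundary; simpl; lra.
  - apply ex_CInt_h; [lra|]. intros. apply Hf. unfold rect_boundary; simpl; lra.
  - apply ex_CInt_h; [lra|]. intros. apply Hg. unfold rect_boundary; simpl; lra.
Qed.

Lemma rect_int_le (g : C -> C) (x0 x1 y0 y1 M : R) :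
  x0 <= x1 -> y0 <= y1 ->
  (forall z, rect_boundary x0 x1 y0 y1 z -> ccont g z) ->
  (forall z, rect_boundary x0 x1 y0 y1 z -> Cmod (g z) <= M) ->
  Cmod (rect_int g x0 x1 y0 y1) <= 2 * ((x1 - x0) + (y1 - y0)) * M.
Proof.
  intros Hx Hy Hc Hg. unfold rect_int.
  assert (A : Cmod (CInt (fun t => g (t, y0)) x0 x1) <= (x1 - x0) * M).
  { apply is_CInt_le with (fun t => g (t, y0)); [lra | |apply CInt_correct, ex_CInt_h; [lra|]];
    intros; [apply Hg | apply Hc]; unfold rect_boundary; simpl; lra. }
  assert (B : Cmod (CInt (fun t => g (t, y1)) x0 x1) <= (x1 - x0) * M).
  { apply is_CInt_le with (fun t => g (t, y1)); [lra | |apply CInt_correct, ex_CInt_h; [lra|]];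
    intros; [apply Hg | apply Hc]; unfold rect_boundary; simpl; lra. }
  assert (D : Cmod (CInt (fun t => g (x0, t)) y0 y1) <= (y1 - y0) * M).
  { apply is_CInt_le with (fun t => g (x0, t)); [lra | |apply CInt_correct, ex_CInt_v; [lra|]];
    intros; [apply Hg | apply Hc]; unfold rect_boundary; simpl; lra. }
  assert (E : Cmod (CInt (fun t => g (x1, t)) y0 y1) <= (y1 - y0) * M).
  { apply is_CInt_le with (fun t => g (x1, t)); [lra | |apply CInt_correct, ex_CInt_v; [lra|]];
    intros; [apply Hg | apply Hc]; unfold rect_boundary; simpl; lra. }
  unfold Cminus.
  eapply Rle_trans; [apply Cmod_triangle|]. rewrite Cmod_opp.
  eapply Rle_trans; [apply Rplus_le_compat_r, Cmod_triangle|]. rewrite Cmod_opp.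
  eapply Rle_trans; [apply Rplus_le_compat_r, Rplus_le_compat_r, Cmod_triangle|].
  rewrite !Cmod_mult, Cmod_Ci. lra.
Qed.

(** A direct computation, independent of Goursat's theorem, whose proof uses it to discard the
    first-order part of [F]. *)
Lemma rect_int_affine (k l : C) (x0 x1 y0 y1 : R) : rect_int (fun w => k + l * w)%C x0 x1 y0 y1 = RtoC 0.
Proof.
  assert (Hid : forall a b, is_RInt (fun t => t) a b ((b ^ 2 - a ^ 2) / 2)).
  { intros a b.
    replace ((b ^ 2 - a ^ 2) / 2) with (minus (b ^ 2 / 2) (a ^ 2 / 2)) by (unfold minus, plus, opp; simpl; field).
    apply (is_RInt_derive (V := R_CompleteNormedModule) (fun t => t ^ 2 / 2) (fun t => t)).
    - intros x _. auto_derive; [trivial | field].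
    - intros x _. apply continuous_id. }
  assert (Hc : forall a b c : R, is_RInt (fun _ => c) a b ((b - a) * c)).
  { intros a b c. apply (is_RInt_const (V := R_NormedModule)). }
  assert (Hh : forall y a b, is_CInt (fun t => (k + l * (t, y))%C) a b
      (k * RtoC (b - a) + l * (((b ^ 2 - a ^ 2) / 2)%R, ((b - a) * y)%R))%C).
  { intros y a b. apply is_CInt_plus.
    - apply (is_CInt_ext (fun _ => k * RtoC 1)%C); [intros; ring|].
      apply is_CInt_mult, is_CInt_pair; simpl.
      + rewrite <- (Rmult_1_r (b - a)). apply Hc.
      + pose proof (Hc a b 0) as H0. rewrite Rmult_0_r in H0. exact H0.
    - apply is_CInt_mult, is_CInt_pair; simpl; [apply Hid | apply Hc]. }
  assert (Hv : forall x a b, is_CInt (fun t => (k + l * (x, t))%C) a b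
      (k * RtoC (b - a) + l * (((b - a) * x)%R, ((b ^ 2 - a ^ 2) / 2)%R))%C).
  { intros y a b. apply is_CInt_plus.
    - apply (is_CInt_ext (fun _ => k * RtoC 1)%C); [intros; ring|].
      apply is_CInt_mult, is_CInt_pair; simpl.
      + rewrite <- (Rmult_1_r (b - a)). apply Hc.
      + pose proof (Hc a b 0) as H0. rewrite Rmult_0_r in H0. exact H0.
    - apply is_CInt_mult, is_CInt_pair; simpl; [apply Hc | apply Hid]. }
  unfold rect_int. rewrite !(is_CInt_unique _ _ _ _ (Hh _ _ _)), !(is_CInt_unique _ _ _ _ (Hv _ _ _)).
  destruct k as [k1 k2], l as [l1 l2]. unfold Cminus, Cmult, Cplus, Copp, Ci, RtoC. simpl.
  f_equal; field.
Qed.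

Lemma rect_int_ext (f g : C -> C) (x0 x1 y0 y1 : R) :
  (forall u, f u = g u) -> rect_int f x0 x1 y0 y1 = rect_int g x0 x1 y0 y1.
Proof.
  intros E. unfold rect_int, CInt.
  rewrite (@RInt_ext C_R_CompleteNormedModule (fun t => f (t, y0)) (fun t => g (t, y0)) x0 x1),
    (@RInt_ext C_R_CompleteNormedModule (fun t => f (t, y1)) (fun t => g (t, y1)) x0 x1),
    (@RInt_ext C_R_CompleteNormedModule (fun t => f (x0, t)) (fun t => g (x0, t)) y0 y1),
    (@RInt_ext C_R_CompleteNormedModule (fun t => f (x1, t)) (fun t => g (x1, t)) y0 y1)
    by (intros; apply E).
  reflexivity.
Qed.

(** * Goursat's theorem *)

Record rect := Rect { xl : R; xr : R; yl : R; yr : R }.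

Definition rect_int_of (F : C -> C) (q : rect) : C := rect_int F (xl q) (xr q) (yl q) (yr q).

Definition in_rect (q : rect) (z : C) : Prop :=
  xl q <= fst z <= xr q /\ yl q <= snd z <= yr q.

Definition sub_rect (p q : rect) : Prop :=
  xl q <= xl p /\ xl p <= xr p /\ xr p <= xr q /\
  yl q <= yl p /\ yl p <= yr p /\ yr p <= yr q.

(** The half that is kept carries at least half of the modulus of the integral: if the left one does
    not, the triangle inequality gives it to the right one. Halving in [x] and then in [y] replaces
    the usual division into four. *)
Definition halve_x (F : C -> C) (q : rect) : rect :=
  let m := (xl q + xr q) / 2 in
  let p := Rect (xl q) m (yl q) (yr q) in
  if Rle_dec (Cmod (rect_int_of F q) / 2) (Cmod (rect_int_of F p)) then p else Rect m (xr q) (yl q) (yr q).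

Definition halve_y (F : C -> C) (q : rect) : rect :=
  let m := (yl q + yr q) / 2 in
  let p := Rect (xl q) (xr q) (yl q) m in
  if Rle_dec (Cmod (rect_int_of F q) / 2) (Cmod (rect_int_of F p)) then p else Rect (xl q) (xr q) m (yr q).

Lemma halve_x_spec (F : C -> C) (q : rect) :
  sub_rect q q -> (forall z, in_rect q z -> ccont F z) ->
  sub_rect (halve_x F q) q /\ xr (halve_x F q) - xl (halve_x F q) = (xr q - xl q) / 2 /\
  yr (halve_x F q) - yl (halve_x F q) = yr q - yl q /\
  Cmod (rect_int_of F q) / 2 <= Cmod (rect_int_of F (halve_x F q)).
Proof.
  destruct q as [a b c d]. unfold sub_rect, in_rect, rect_int_of, halve_x; simpl. intros Hq HF.
  set (m := (a + b) / 2).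
  assert (Hm : a <= m <= b) by (unfold m; lra).
  assert (Hm2 : m - a = (b - a) / 2 /\ b - m = (b - a) / 2) by (unfold m; lra).
  assert (E : rect_int F a b c d = (rect_int F a m c d + rect_int F m b c d)%C).
  { apply rect_int_split_x; [lra.. | |]; intros; apply HF; simpl; lra. }
  unfold rect_int_of; simpl. destruct (Rle_dec _ _) as [H|H]; simpl.
  - lra.
  - pose proof (Cmod_triangle (rect_int F a m c d) (rect_int F m b c d)). rewrite <- E in H0. lra.
Qed.

Lemma halve_y_spec (F : C -> C) (q : rect) :
  sub_rect q q -> (forall z, in_rect q z -> ccont F z) ->
  sub_rect (halve_y F q) q /\ xr (halve_y F q) - xl (halve_y F q) = xr q - xl q /\
  yr (halve_y F q) - yl (halve_y F q) = (yr q - yl q) / 2 /\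
  Cmod (rect_int_of F q) / 2 <= Cmod (rect_int_of F (halve_y F q)).
Proof.
  destruct q as [a b c d]. unfold sub_rect, in_rect, rect_int_of, halve_y; simpl. intros Hq HF.
  set (m := (c + d) / 2).
  assert (Hm : c <= m <= d) by (unfold m; lra).
  assert (Hm2 : m - c = (d - c) / 2 /\ d - m = (d - c) / 2) by (unfold m; lra).
  assert (E : rect_int F a b c d = (rect_int F a b c m + rect_int F a b m d)%C).
  { apply rect_int_split_y; [lra.. | |]; intros; apply HF; simpl; lra. }
  unfold rect_int_of; simpl. destruct (Rle_dec _ _) as [H|H]; simpl.
  - lra.
  - pose proof (Cmod_triangle (rect_int F a b c m) (rect_int F a b m d)). rewrite <- E in H0. lra.
Qed.

Fixpoint nest (F : C -> C) (q : rect) (n : nat) : rect :=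
  match n with O => q | S n => halve_y F (halve_x F (nest F q n)) end.

(** Sides shrink like [2 ^ (- n)] while the integral loses at most a factor 4 per round, hence the
    power [(/ 2) ^ n] twice in the last bound. *)
Lemma nest_step (F : C -> C) (q : rect) (n : nat) :
  sub_rect q q -> (forall z, in_rect q z -> ccont F z) ->
  sub_rect (nest F q n) q /\ sub_rect (nest F q (S n)) (nest F q n) /\
  xr (nest F q n) - xl (nest F q n) = (xr q - xl q) * (/ 2) ^ n /\
  yr (nest F q n) - yl (nest F q n) = (yr q - yl q) * (/ 2) ^ n /\
  Cmod (rect_int_of F q) * (/ 2) ^ n * (/ 2) ^ n <= Cmod (rect_int_of F (nest F q n)).
Proof.
  intros Hq HF.
  assert (Hstep : forall p, sub_rect p q ->
    sub_rect (halve_y F (halve_x F p)) p /\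
    xr (halve_y F (halve_x F p)) - xl (halve_y F (halve_x F p)) = (xr p - xl p) / 2 /\
    yr (halve_y F (halve_x F p)) - yl (halve_y F (halve_x F p)) = (yr p - yl p) / 2 /\
    Cmod (rect_int_of F p) / 4 <= Cmod (rect_int_of F (halve_y F (halve_x F p)))).
  { intros p Hp. destruct (halve_x_spec F p) as [A1 [A2 [A3 A4]]].
    - unfold sub_rect in *; lra.
    - intros z Hz. apply HF. unfold sub_rect, in_rect in *; lra.
    - destruct (halve_y_spec F (halve_x F p)) as [B1 [B2 [B3 B4]]].
      + unfold sub_rect in *; lra.
      + intros z Hz. apply HF. unfold sub_rect, in_rect in *; lra.
      + unfold sub_rect in *; lra. }
  induction n as [|n IH].
  - simpl. destruct (Hstep q Hq) as [A _]. repeat split; try apply Hq; try apply A; try lra.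
  - destruct IH as [A1 [A2 [A3 [A4 A5]]]].
    assert (A6 : sub_rect (nest F q (S n)) q) by (unfold sub_rect in *; lra).
    destruct (Hstep _ A6) as [B1 _].
    destruct (Hstep _ A1) as [_ [C2 [C3 C4]]].
    split; [exact A6|]. split; [exact B1|]. simpl. lra.
Qed.

Lemma half_pow_small (W e : R) : 0 < e -> exists n, W * (/ 2) ^ n < e.
Proof.
  intros He. destruct (Rle_dec W 0) as [HW|HW].
  - exists O. simpl. lra.
  - assert (Hd : 0 < e / W) by (apply Rdiv_lt_0_compat; lra).
    destruct (pow_lt_1_zero (/ 2) (ltac:(rewrite Rabs_pos_eq; lra)) _ Hd) as [n Hn].
    exists n. specialize (Hn n (Nat.le_refl n)).
    rewrite Rabs_pos_eq in Hn by (apply pow_le; lra).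
    apply Rlt_le_trans with (W * (e / W)); [apply Rmult_lt_compat_l; lra|].
    right. field. lra.
Qed.

(** The common point is the supremum of the left ends, which every right end bounds. *)
Lemma nested_intervals (a b : nat -> R) :
  (forall n, a n <= a (S n) /\ a n <= b n /\ b (S n) <= b n) ->
  exists c, forall n, a n <= c <= b n.
Proof.
  intros H.
  assert (Ha : forall n k, a n <= a (n + k)%nat).
  { intros n k. induction k; [rewrite Nat.add_0_r; lra|].
    rewrite Nat.add_succ_r. destruct (H (n + k)%nat); lra. }
  assert (Hb : forall n k, b (n + k)%nat <= b n).
  { intros n k. induction k; [rewrite Nat.add_0_r; lra|].
    rewrite Nat.add_succ_r. destruct (H (n + k)%nat) as [_ [_ ?]]; lra. }
  assert (Hab : forall n m, a n <= b m).
  { intros n m. pose proof (Ha n m). pose proof (Hb m n).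
    rewrite (Nat.add_comm m n) in *. destruct (H (n + m)%nat); lra. }
  destruct (completeness (fun x => exists n, x = a n)) as [c [Hc1 Hc2]].
  - exists (b O). intros x [n ->]. apply Hab.
  - exists (a O). exists O. reflexivity.
  - exists c. intros n. split.
    + apply Hc1. exists n. reflexivity.
    + apply Hc2. intros x [m ->]. apply Hab.
Qed.

Lemma Cmod_le_sum (z : C) : Cmod z <= Rabs (fst z) + Rabs (snd z).
Proof.
  replace z with ((fst z, 0) + (0, snd z))%C at 1
    by (destruct z; unfold Cplus; simpl; f_equal; ring).
  eapply Rle_trans; [apply Cmod_triangle|]. rewrite Cmod_re, Cmod_im. lra.
Qed.

(** Near the common point [c] of the nested rectangles, [F] minus its affine part is at most
    [eps * |z - c|]. With half-perimeter [sn] this bounds the integral by [2 * eps * sn ^ 2], which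
    decays like [4 ^ (- n)], the same rate as the lower bound of [nest_step]; a small [eps] makes
    the two incompatible. *)
Theorem goursat (F : C -> C) (x0 x1 y0 y1 : R) :
  x0 <= x1 -> y0 <= y1 ->
  (forall z, x0 <= fst z <= x1 -> y0 <= snd z <= y1 -> holo F z) ->
  rect_int F x0 x1 y0 y1 = RtoC 0.
Proof.
  intros Hx Hy HF. set (q := Rect x0 x1 y0 y1).
  assert (Hq : sub_rect q q) by (unfold sub_rect, q; simpl; lra).
  assert (HFc : forall z, in_rect q z -> ccont F z).
  { intros z [H1 H2]. apply holo_ccont, HF; assumption. }
  assert (HN := fun n => nest_step F q n Hq HFc).
  destruct (nested_intervals (fun n => xl (nest F q n)) (fun n => xr (nest F q n))) as [cx Hcx].
  { intros n. destruct (HN n) as [A [B _]]. unfold sub_rect in *; lra. }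
  destruct (nested_intervals (fun n => yl (nest F q n)) (fun n => yr (nest F q n))) as [cy Hcy].
  { intros n. destruct (HN n) as [A [B _]]. unfold sub_rect in *; lra. }
  apply Cmod_eq_0. destruct (Req_dec (Cmod (rect_int F x0 x1 y0 y1)) 0) as [E|E]; [exact E|exfalso].
  change (rect_int F x0 x1 y0 y1) with (rect_int_of F q) in E.
  set (eta := Cmod (rect_int_of F q)) in *.
  assert (He : 0 < eta) by (pose proof (Cmod_ge_0 (rect_int_of F q)); unfold eta in *; lra).
  set (s := (x1 - x0) + (y1 - y0)).
  assert (Hs : 0 <= s) by (unfold s; lra).
  (* Chosen so that [2 * eps * s ^ 2 < eta]; the [+ 1] keeps the denominator positive for a
     degenerate rectangle. *)
  set (eps := eta / (4 * (s * s + 1))).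
  assert (Heps : 0 < eps) by (apply Rdiv_lt_0_compat; nra).
  set (c := (cx, cy) : C).
  destruct (HF c) as [d [p [Hp [Ep HFd]]]]; [apply (Hcx O) | apply (Hcy O) |].
  destruct (near_and _ _ _ (Hp eps Heps) HFd) as [r [Hr Hnear]].
  destruct (half_pow_small s r Hr) as [n Hn].
  destruct (HN n) as [A1 [A2 [A3 [A4 A5]]]].
  specialize (Hcx n). specialize (Hcy n). simpl in Hcx, Hcy.
  set (b := nest F q n) in *.
  set (sn := s * (/ 2) ^ n) in *.
  assert (Esn : (xr b - xl b) + (yr b - yl b) = sn) by (unfold sn, s; simpl in *; lra).
  assert (Hcl : forall z, in_rect b z -> Cmod (z - c) <= sn).
  { intros z [Hz1 Hz2]. eapply Rle_trans; [apply Cmod_le_sum|]. simpl.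
    rewrite <- Esn. apply Rplus_le_compat; apply Rabs_le; lra. }
  assert (Hbd : forall z, rect_boundary (xl b) (xr b) (yl b) (yr b) z -> in_rect b z).
  { intros z [Hz1 [Hz2 _]]. split; assumption. }
  assert (Hcb : forall z, in_rect b z -> ccont F z).
  { intros z Hz. apply HFc. unfold sub_rect, in_rect in *; lra. }
  assert (Hca : forall z, ccont (fun w => (F c - d * c) + d * w)%C z).
  { intros z. apply ccont_plus; [apply ccont_const|].
    apply ccont_mult; [apply ccont_const | apply ccont_id]. }
  assert (Hb : xl b <= xr b /\ yl b <= yr b) by (unfold sub_rect in *; lra).
  (* Subtracting the affine part does not change the integral and leaves the integrand
     [(p z - p c) * (z - c)]. *)
  assert (EF : rect_int_of F b = rect_int (fun w => 1 * F w + (- (1)) * ((F c - d * c) + d * w))%C (xl b) (xr b) (yl b) (yr b)).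
  { rewrite rect_int_lin; [|lra|lra| intros; apply Hcb, Hbd; assumption | intros; apply Hca].
    rewrite rect_int_affine. unfold rect_int_of. ring. }
  assert (Hle : Cmod (rect_int_of F b) <= 2 * sn * (eps * sn)).
  { rewrite EF, <- Esn. apply rect_int_le; [lra | lra | |].
    - intros z Hz. apply ccont_plus; apply ccont_mult; try apply ccont_const;
      [apply Hcb, Hbd; assumption | apply Hca].
    - rewrite Esn. intros z Hz. pose proof (Hcl z (Hbd z Hz)) as Hz1.
      destruct (Hnear z) as [H1 H2]; [lra|].
      replace (1 * F z + - (1) * (F c - d * c + d * z))%C with ((p z - p c) * (z - c))%C
        by (rewrite Ep, H2; ring).
      rewrite Cmod_mult. apply Rmult_le_compat; try apply Cmod_ge_0; lra. }
  assert (Hp2 : 0 < (/ 2) ^ n) by (apply pow_lt; lra).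
  set (h := (/ 2) ^ n) in *.
  assert (H1 : eta * (h * h) <= 2 * eps * (s * s) * (h * h)) by (unfold sn in Hle; nra).
  assert (H2 : eta <= 2 * eps * (s * s)) by (apply Rmult_le_reg_r with (h * h); nra).
  assert (H3 : eps * (4 * (s * s + 1)) = eta) by (unfold eps; field; nra).
  nra.
Qed.

(** * Simple poles *)

Lemma sq_plus_sq_pos (a e : R) : 0 < e -> 0 < a ^ 2 + e ^ 2.
Proof. intros He. pose proof (pow2_ge_0 a). pose proof (pow_lt e 2 He). lra. Qed.

Lemma is_RInt_recip_re (c e : R) : 0 < e ->
  is_RInt (fun t => (t - c) / ((t - c) ^ 2 + e ^ 2)) (c - e) (c + e) 0.
Proof.
  intros He.
  replace 0 with (minus (ln ((c + e - c) ^ 2 + e ^ 2) / 2) (ln ((c - e - c) ^ 2 + e ^ 2) / 2)).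
  2: { replace ((c + e - c) ^ 2) with ((c - e - c) ^ 2) by ring. apply (@minus_eq_zero R_AbelianGroup). }
  assert (Hp := fun x => sq_plus_sq_pos (x - c) e He).
  apply (is_RInt_derive (V := R_CompleteNormedModule) (fun t => ln ((t - c) ^ 2 + e ^ 2) / 2)).
  - intros x _. specialize (Hp x). auto_derive; [exact Hp | field; apply Rgt_not_eq, Hp].
  - intros x _. apply (ex_derive_continuous (K := R_AbsRing) (V := R_NormedModule)).
    auto_derive. apply Rgt_not_eq, (Hp x).
Qed.

Lemma is_RInt_recip_im (c e : R) : 0 < e ->
  is_RInt (fun t => e / ((t - c) ^ 2 + e ^ 2)) (c - e) (c + e) (PI / 2).
Proof.
  intros He.
  replace (PI / 2) with (minus (atan ((c + e - c) / e)) (atan ((c - e - c) / e))).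
  2: { replace ((c + e - c) / e) with 1 by (field; lra).
       replace ((c - e - c) / e) with (Ropp 1) by (field; lra).
       rewrite atan_opp, atan_1. unfold minus, plus, opp; simpl. field. }
  assert (Hp := fun x => sq_plus_sq_pos (x - c) e He).
  apply (is_RInt_derive (V := R_CompleteNormedModule) (fun t => atan ((t - c) / e))).
  - intros x _. specialize (Hp x). auto_derive; [trivial|].
    unfold Rsqr. field. repeat split; lra.
  - intros x _. apply (ex_derive_continuous (K := R_AbsRing) (V := R_NormedModule)).
    auto_derive. apply Rgt_not_eq, (Hp x).
Qed.

(** Equations coming from [is_RInt_ext] are typed in the carrier of a normed module; they are
    restated in [R] for [field]. *)
Ltac eq_in_R := match goal with |- @eq _ ?a ?b => change (@eq R a b) end.

(** On a square centred at the pole, each side contributes [PI / 2] through an arctangent, and the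
    remaining component cancels by symmetry. The sign [s] selects one of two opposite sides. *)
Lemma rect_int_recip_square (cx cy e : R) : 0 < e ->
  rect_int (fun w => / (w - (cx, cy)))%C (cx - e) (cx + e) (cy - e) (cy + e) = (2 * PI * Ci)%C.
Proof.
  intros He.
  assert (Hre : forall c s, s = 1 \/ s = - 1 -> is_RInt (fun t => s * ((t - c) / ((t - c) ^ 2 + e ^ 2))) (c - e) (c + e) 0).
  { intros c s _. rewrite <- (Rmult_0_r s).
    apply (is_RInt_scal (V := R_NormedModule)), is_RInt_recip_re, He. }
  assert (Him : forall c s, is_RInt (fun t => s * (e / ((t - c) ^ 2 + e ^ 2))) (c - e) (c + e) (s * (PI / 2))).
  { intros c s. apply (is_RInt_scal (V := R_NormedModule)), is_RInt_recip_im, He. }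
  assert (Hp := fun t => sq_plus_sq_pos (t - cx) e He).
  assert (Hh : forall s, s = 1 \/ s = - 1 ->
    is_CInt (fun t => / ((t, (cy + s * e)%R) - (cx, cy)))%C (cx - e) (cx + e) (0, (- s * (PI / 2))%R)).
  { intros s Hs. assert (Hs2 : (cy + s * e + - cy) ^ 2 = e ^ 2) by (destruct Hs; subst s; ring).
    apply is_CInt_pair.
    - eapply (is_RInt_ext (V := R_NormedModule)); [|exact (Hre cx 1 (or_introl eq_refl))].
      intros t _. unfold Cinv, Cminus, Cplus, Copp; cbn [fst snd]. rewrite Hs2. eq_in_R. field. pose proof (Hp t). repeat split; lra.
    - eapply (is_RInt_ext (V := R_NormedModule)); [|exact (Him cx (- s))].
      intros t _. unfold Cinv, Cminus, Cplus, Copp; cbn [fst snd]. rewrite Hs2. eq_in_R. field. pose proof (Hp t). repeat split; lra. }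
  clear Hp. assert (Hp := fun t => sq_plus_sq_pos (t - cy) e He).
  assert (Hv : forall s, s = 1 \/ s = - 1 ->
    is_CInt (fun t => / (((cx + s * e)%R, t) - (cx, cy)))%C (cy - e) (cy + e) ((s * (PI / 2))%R, 0)).
  { intros s Hs. assert (Hs2 : (cx + s * e + - cx) ^ 2 = e ^ 2) by (destruct Hs; subst s; ring).
    apply is_CInt_pair.
    - eapply (is_RInt_ext (V := R_NormedModule)); [|exact (Him cy s)].
      intros t _. unfold Cinv, Cminus, Cplus, Copp; cbn [fst snd]. rewrite Hs2. eq_in_R. field. pose proof (Hp t). repeat split; lra.
    - eapply (is_RInt_ext (V := R_NormedModule)); [|exact (Hre cy (-1) (or_intror eq_refl))].
      intros t _. unfold Cinv, Cminus, Cplus, Copp; cbn [fst snd]. rewrite Hs2. eq_in_R. field. pose proof (Hp t). repeat split; lra. }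
  pose proof (is_CInt_unique _ _ _ _ (Hh (-1) (or_intror eq_refl))) as E1.
  pose proof (is_CInt_unique _ _ _ _ (Hh 1 (or_introl eq_refl))) as E2.
  pose proof (is_CInt_unique _ _ _ _ (Hv (-1) (or_intror eq_refl))) as E3.
  pose proof (is_CInt_unique _ _ _ _ (Hv 1 (or_introl eq_refl))) as E4.
  replace (cy + -1 * e) with (cy - e) in E1 by ring.
  replace (cy + 1 * e) with (cy + e) in E2 by ring.
  replace (cx + -1 * e) with (cx - e) in E3 by ring.
  replace (cx + 1 * e) with (cx + e) in E4 by ring.
  unfold rect_int. rewrite E1, E2, E3, E4.
  unfold Cminus, Cmult, Cplus, Copp, Ci, RtoC. simpl. f_equal; field.
Qed.

Lemma Cminus_neq_0 (w c : C) : w <> c -> (w - c)%C <> RtoC 0.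
Proof. intros H E. apply H. transitivity ((w - c) + c)%C; [ring | rewrite E; ring]. Qed.

(** The residue at a pole of order at most one, as a limit. The centre is excluded because a
    quotient takes a default value there. *)
Definition has_residue (F : C -> C) (c rho : C) : Prop :=
  forall eps, 0 < eps -> near c (fun w => w <> c -> Cmod ((w - c) * F w - rho) < eps).

Lemma rect_boundary_square_dist (cx cy e : R) (z : C) :
  0 < e -> rect_boundary (cx - e) (cx + e) (cy - e) (cy + e) z ->
  e <= Cmod (z - (cx, cy)) <= 2 * e.
Proof.
  intros He [H1 [H2 H3]]. split.
  - eapply Rle_trans; [|apply Rmax_Cmod]. simpl.
    destruct H3 as [E|[E|[E|E]]]; rewrite E.
    + eapply Rle_trans; [|apply Rmax_l]. replace (cx - e + - cx) with (- e) by ring.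
      rewrite Rabs_Ropp. apply Rle_abs.
    + eapply Rle_trans; [|apply Rmax_l]. replace (cx + e + - cx) with e by ring. apply Rle_abs.
    + eapply Rle_trans; [|apply Rmax_r]. replace (cy - e + - cy) with (- e) by ring.
      rewrite Rabs_Ropp. apply Rle_abs.
    + eapply Rle_trans; [|apply Rmax_r]. replace (cy + e + - cy) with e by ring. apply Rle_abs.
  - eapply Rle_trans; [apply Cmod_le_sum|]. simpl.
    assert (Rabs (fst z + - cx) <= e) by (apply Rabs_le; lra).
    assert (Rabs (snd z + - cy) <= e) by (apply Rabs_le; lra). lra.
Qed.

(** Two vertical and two horizontal cuts divide the frame around the inner rectangle into four
    rectangles on which Goursat's theorem applies. Holomorphy is asked off the open inner rectangle,
    so its boundary is covered. *)
Lemma rect_int_shrink (F : C -> C) (x0 x1 y0 y1 a b c d : R) :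
  x0 <= a < b -> b <= x1 -> y0 <= c < d -> d <= y1 ->
  (forall z, x0 <= fst z <= x1 -> y0 <= snd z <= y1 ->
     ~ (a < fst z < b /\ c < snd z < d) -> holo F z) ->
  rect_int F x0 x1 y0 y1 = rect_int F a b c d.
Proof.
  intros Ha Hb Hc Hd HF.
  assert (HFc : forall s t, x0 <= s <= x1 -> y0 <= t <= y1 ->
     ~ (a < s < b /\ c < t < d) -> ccont F (s, t)).
  { intros s t Hs Ht H. apply holo_ccont, HF; simpl; assumption. }
  rewrite (rect_int_split_x F x0 a x1), (rect_int_split_x F a b x1), (rect_int_split_y F a b y0 c y1),
    (rect_int_split_y F a b c d y1);
    try lra; try (intros; apply HFc; lra).
  rewrite (goursat F x0 a), (goursat F b x1), (goursat F a b y0 c), (goursat F a b d y1);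
    try lra; try (intros; apply HF; lra).
  ring.
Qed.

(** On a small square of half-side [e] around the pole, [F - rho / (w - c)] is at most [eps / e],
    and the contour has length [8 * e]. The discrepancy [D] is therefore at most [8 * eps] for every
    [eps]. *)
Theorem rect_int_simple_pole (F : C -> C) (x0 x1 y0 y1 cx cy : R) (rho : C) :
  x0 < cx < x1 -> y0 < cy < y1 ->
  (forall z, x0 <= fst z <= x1 -> y0 <= snd z <= y1 -> z <> (cx, cy) -> holo F z) ->
  has_residue F (cx, cy) rho ->
  rect_int F x0 x1 y0 y1 = (2 * PI * Ci * rho)%C.
Proof.
  intros Hx Hy HF Hres.
  set (D := (rect_int F x0 x1 y0 y1 - 2 * PI * Ci * rho)%C).
  assert (HD : forall eps, 0 < eps -> Cmod D <= 8 * eps).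
  { intros eps Heps. destruct (Hres eps Heps) as [r [Hr Hn]].
    (* [r / 3] because points of the square's boundary are only known to be within [2 * e] of the
       centre. *)
    set (e := Rmin (r / 3) (Rmin (Rmin (cx - x0) (x1 - cx)) (Rmin (cy - y0) (y1 - cy)))).
    assert (He : 0 < e) by (repeat apply Rmin_pos; lra).
    assert (Hle : e <= r / 3 /\ e <= cx - x0 /\ e <= x1 - cx /\ e <= cy - y0 /\ e <= y1 - cy).
    { unfold e.
      pose proof (Rmin_l (r / 3) (Rmin (Rmin (cx - x0) (x1 - cx)) (Rmin (cy - y0) (y1 - cy)))).
      pose proof (Rmin_r (r / 3) (Rmin (Rmin (cx - x0) (x1 - cx)) (Rmin (cy - y0) (y1 - cy)))).
      pose proof (Rmin_l (Rmin (cx - x0) (x1 - cx)) (Rmin (cy - y0) (y1 - cy))).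
      pose proof (Rmin_r (Rmin (cx - x0) (x1 - cx)) (Rmin (cy - y0) (y1 - cy))).
      pose proof (Rmin_l (cx - x0) (x1 - cx)). pose proof (Rmin_r (cx - x0) (x1 - cx)).
      pose proof (Rmin_l (cy - y0) (y1 - cy)). pose proof (Rmin_r (cy - y0) (y1 - cy)).
      lra. }
    assert (Hpt : forall z, rect_boundary (cx - e) (cx + e) (cy - e) (cy + e) z -> z <> (cx, cy)).
    { intros z Hz E. pose proof (rect_boundary_square_dist _ _ _ _ He Hz) as H.
      rewrite E in H. replace ((cx, cy) - (cx, cy))%C with (RtoC 0) in H by ring.
      rewrite Cmod_0 in H. lra. }
    assert (Hcr : forall z, z <> (cx, cy) -> ccont (fun w => / (w - (cx, cy)))%C z).
    { intros z Hz. apply ccont_inv.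
      - apply ccont_plus; [apply ccont_id | apply ccont_const].
      - apply Cminus_neq_0, Hz. }
    assert (HcF : forall z, rect_boundary (cx - e) (cx + e) (cy - e) (cy + e) z -> ccont F z).
    { intros z Hz. apply holo_ccont, HF; [| | apply Hpt, Hz]; destruct Hz as [? [? _]]; lra. }
    assert (ED : D = rect_int (fun w => 1 * F w + (- rho) * / (w - (cx, cy)))%C
       (cx - e) (cx + e) (cy - e) (cy + e)).
    { rewrite rect_int_lin; [|lra|lra| assumption | intros; apply Hcr, Hpt; assumption].
      rewrite rect_int_recip_square by exact He. unfold D.
      rewrite (rect_int_shrink F x0 x1 y0 y1 (cx - e) (cx + e) (cy - e) (cy + e)); try lra.
      - ring.
      - intros z Hz1 Hz2 Hz3. apply HF; [assumption..|].
        intros E. apply Hz3. rewrite E. simpl. lra. }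
    rewrite ED.
    replace (8 * eps) with (2 * ((cx + e - (cx - e)) + (cy + e - (cy - e))) * (eps / e)) by (field; lra).
    apply rect_int_le; [lra | lra | |].
    - intros z Hz. apply ccont_plus; apply ccont_mult; try apply ccont_const;
      [apply HcF; assumption | apply Hcr, Hpt; assumption].
    - intros z Hz. pose proof (rect_boundary_square_dist _ _ _ _ He Hz) as Hz1.
      specialize (Hn z ltac:(lra) (Hpt z Hz)).
      assert (Hz0 : (z - (cx, cy))%C <> RtoC 0).
      { apply Cmod_gt_0. lra. }
      replace (1 * F z + - rho * / (z - (cx, cy)))%C
        with (((z - (cx, cy)) * F z - rho) * / (z - (cx, cy)))%C by (field; exact Hz0).
      rewrite Cmod_mult, Cmod_inv by exact Hz0.
      apply Rmult_le_compat; [apply Cmod_ge_0 | | lra |].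
      + apply Rlt_le, Rinv_0_lt_compat. lra.
      + apply Rinv_le_contravar; lra. }
  assert (H0 : D = RtoC 0).
  { apply Cmod_eq_0. destruct (Req_dec (Cmod D) 0) as [E|E]; [exact E|].
    pose proof (Cmod_ge_0 D). specialize (HD (Cmod D / 16) ltac:(lra)). lra. }
  replace (rect_int F x0 x1 y0 y1) with (D + 2 * PI * Ci * rho)%C by (unfold D; ring).
  rewrite H0. ring.
Qed.

(** With [q] the continuous slope of [D] at its zero [c], [(w - c) * N w / D w] is exactly
    [N w / q w], which is continuous at [c]. *)
Lemma has_residue_quot (N D : C -> C) (c d : C) :
  ccont N c -> cdiff D c d -> D c = RtoC 0 -> d <> RtoC 0 ->
  has_residue (fun w => N w / D w)%C c (N c / d)%C.
Proof.
  intros HN [q [Hq [Eq HD]]] H0 Hd eps Heps.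
  assert (Hqc : q c <> RtoC 0) by (rewrite Eq; exact Hd).
  assert (Hc : ccont (fun w => N w * / q w)%C c).
  { apply ccont_mult; [exact HN | apply ccont_inv; assumption]. }
  refine (near_mono _ _ _ _ (near_and _ _ _ HD
    (near_and _ _ _ (ccont_neq0 _ _ Hq Hqc) (Hc eps Heps)))).
  intros w [H1 [H2 H3]] Hw.
  assert (Hqw : q w <> RtoC 0) by (apply Cmod_gt_0; pose proof (Cmod_ge_0 (q c)); lra).
  pose proof (Cminus_neq_0 _ _ Hw) as Hwc.
  rewrite H1, H0. rewrite Eq in H3.
  replace ((w - c) * (N w / (0 + q w * (w - c))) - N c / d)%C
    with (N w * / q w - N c * / d)%C; [exact H3|].
  field. repeat split; assumption.
Qed.

(** * Elementary functions *)

Lemma cexp_plus (z w : C) : cexp (z + w) = (cexp z * cexp w)%C.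
Proof.
  destruct z as [a b], w as [c d]. unfold cexp, Cmult, Cplus, Re, Im; simpl.
  rewrite exp_plus, cos_plus, sin_plus. f_equal; ring.
Qed.

Lemma cexp_0 : cexp 0 = RtoC 1.
Proof. unfold cexp, RtoC; simpl. rewrite exp_0, cos_0, sin_0. f_equal; ring. Qed.

Lemma Cmod_cexp (z : C) : Cmod (cexp z) = exp (Re z).
Proof.
  unfold Cmod, cexp; simpl. pose proof (sin2_cos2 (Im z)) as H. unfold Rsqr in H.
  transitivity (sqrt (exp (Re z) * exp (Re z))).
  - f_equal. transitivity (exp (Re z) * exp (Re z) * (sin (Im z) * sin (Im z) + cos (Im z) * cos (Im z))); [ring | rewrite H; ring].
  - apply sqrt_square, Rlt_le, exp_pos.
Qed.

Lemma cexp_neq_0 (z : C) : cexp z <> RtoC 0.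
Proof. apply Cmod_gt_0. rewrite Cmod_cexp. apply exp_pos. Qed.

Lemma derivable_0_little_o (f : R -> R) (l eps : R) :
  derivable_pt_lim f 0 l -> 0 < eps ->
  exists d, 0 < d /\ forall h, Rabs h < d -> Rabs (f h - f 0 - l * h) <= eps * Rabs h.
Proof.
  intros H He. destruct (H eps He) as [d Hd]. exists d. split; [apply cond_pos|].
  intros h Hh. destruct (Req_dec h 0) as [->|Hh0].
  - replace (f 0 - f 0 - l * 0) with 0 by ring. rewrite Rabs_R0. lra.
  - specialize (Hd h Hh0 Hh). rewrite Rplus_0_l in Hd.
    replace (f h - f 0 - l * h) with (((f h - f 0) / h - l) * h) by (field; exact Hh0).
    rewrite Rabs_mult. apply Rmult_le_compat_r; [apply Rabs_pos | lra].
Qed.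

(** Real and imaginary parts are written in terms of the first-order remainders [E], [S], [K] of the
    real [exp], [sin] and [cos] at 0. *)
Lemma cexp_little_o (eps : R) : 0 < eps ->
  exists d, 0 < d /\ forall v, Cmod v < d -> Cmod (cexp v - 1 - v) <= eps * Cmod v.
Proof.
  (* The two components cost [3 * e] and [4 * e], whence the 7; [e <= 1] gives [|1 + x| <= 2]. *)
  intros He. set (e := Rmin 1 (eps / 7)).
  assert (He0 : 0 < e) by (apply Rmin_pos; lra).
  assert (He1 : e <= 1) by apply Rmin_l.
  assert (He2 : e <= eps / 7) by apply Rmin_r.
  clearbody e.
  destruct (derivable_0_little_o exp 1 e) as [d1 [Hd1 H1]];
    [rewrite <- exp_0; apply derivable_pt_lim_exp | exact He0 |].
  destruct (derivable_0_little_o sin 1 e) as [d2 [Hd2 H2]];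
    [rewrite <- cos_0; apply derivable_pt_lim_sin | exact He0 |].
  destruct (derivable_0_little_o cos 0 e) as [d3 [Hd3 H3]];
    [replace 0 with (- sin 0) at 2 by (rewrite sin_0; ring); apply derivable_pt_lim_cos | exact He0 |].
  exists (Rmin (Rmin d1 d2) (Rmin d3 e)). split; [repeat apply Rmin_pos; assumption|].
  intros [x y] Hv.
  pose proof (Rmin_l (Rmin d1 d2) (Rmin d3 e)). pose proof (Rmin_r (Rmin d1 d2) (Rmin d3 e)).
  pose proof (Rmin_l d1 d2). pose proof (Rmin_r d1 d2).
  pose proof (Rmin_l d3 e). pose proof (Rmin_r d3 e).
  assert (Hx : Rabs x <= Cmod (x, y)) by exact (re_le_Cmod (x, y)).
  assert (Hy : Rabs y <= Cmod (x, y)).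
  { eapply Rle_trans; [|apply Rmax_Cmod]. apply Rmax_r. }
  set (V := Cmod (x, y)) in *.
  specialize (H1 x ltac:(lra)). specialize (H2 y ltac:(lra)). specialize (H3 y ltac:(lra)).
  rewrite exp_0 in H1. rewrite sin_0 in H2. rewrite cos_0 in H3.
  eapply Rle_trans; [apply Cmod_le_sum|].
  unfold cexp, Cminus, Cplus, Copp, RtoC; cbn [fst snd Re Im].
  pose proof (Rabs_pos x). pose proof (Rabs_pos y).
  assert (B1 : Rabs (cos y) <= 1) by (apply Rabs_le; pose proof (COS_bound y); lra).
  assert (B2 : Rabs (sin y) <= 1) by (apply Rabs_le; pose proof (SIN_bound y); lra).
  assert (B3 : Rabs (1 + x) <= 2).
  { eapply Rle_trans; [apply Rabs_triang|]. rewrite Rabs_R1. lra. }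
  replace (exp x * cos y + - (1) + - x) with
    ((exp x - 1 - 1 * x) * cos y + (1 + x) * (cos y - 1 - 0 * y)) by ring.
  replace (exp x * sin y + - 0 + - y) with
    ((exp x - 1 - 1 * x) * sin y + ((1 + x) * (sin y - 0 - 1 * y) + x * y)) by ring.
  set (E := exp x - 1 - 1 * x) in *. set (S := sin y - 0 - 1 * y) in *.
  set (K := cos y - 1 - 0 * y) in *.
  assert (T1 : Rabs (E * cos y + (1 + x) * K) <= 3 * e * V).
  { eapply Rle_trans; [apply Rabs_triang|]. rewrite !Rabs_mult.
    pose proof (Rmult_le_compat _ _ _ _ (Rabs_pos E) (Rabs_pos (cos y)) H1 B1).
    pose proof (Rmult_le_compat _ _ _ _ (Rabs_pos (1 + x)) (Rabs_pos K) B3 H3).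
    nra. }
  assert (T2 : Rabs (E * sin y + ((1 + x) * S + x * y)) <= 4 * e * V).
  { eapply Rle_trans; [apply Rabs_triang|].
    eapply Rle_trans; [apply Rplus_le_compat_l, Rabs_triang|]. rewrite !Rabs_mult.
    pose proof (Rmult_le_compat _ _ _ _ (Rabs_pos E) (Rabs_pos (sin y)) H1 B2).
    pose proof (Rmult_le_compat _ _ _ _ (Rabs_pos (1 + x)) (Rabs_pos S) B3 H2).
    nra. }
  nra.
Qed.

(** The addition law moves the problem to 0, where the slope is [E], the function [(exp v - 1) / v]
    completed by 1. *)
Lemma cdiff_cexp (z : C) : cdiff cexp z (cexp z).
Proof.
  set (E := fun v : C => if Ceq_dec v 0 then RtoC 1
                         else ((cexp v - 1) / v)%C).
  assert (E0 : E 0 = RtoC 1).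
  { unfold E. destruct (Ceq_dec _ _) as [_|n]; [reflexivity | now elim n]. }
  assert (HE : ccont E 0).
  { intros eps He. destruct (cexp_little_o (eps / 2)) as [d [Hd H]]; [lra|].
    exists d. split; [exact Hd|]. intros v Hv.
    replace (v - 0)%C with v in Hv by ring. rewrite E0. unfold E.
    destruct (Ceq_dec _ _) as [_|n].
    - replace (1 - 1)%C with (RtoC 0) by ring. rewrite Cmod_0. exact He.
    - specialize (H v Hv). assert (Hp : 0 < Cmod v) by (apply Cmod_gt_0, n).
      replace ((cexp v - 1) / v - 1)%C with ((cexp v - 1 - v) * / v)%C by (field; exact n).
      rewrite Cmod_mult, Cmod_inv by exact n.
      apply Rle_lt_trans with (eps / 2 * Cmod v * / Cmod v).
      + apply Rmult_le_compat_r; [apply Rlt_le, Rinv_0_lt_compat, Hp | exact H].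
      + rewrite Rmult_assoc, Rinv_r; lra. }
  exists (fun w => cexp z * E (w - z))%C. split; [|split].
  - apply ccont_mult; [apply ccont_const|].
    apply (ccont_comp E (fun w => w - z)%C).
    + apply ccont_plus; [apply ccont_id | apply ccont_const].
    + replace (z - z)%C with (RtoC 0) by ring. exact HE.
  - replace (z - z)%C with (RtoC 0) by ring. rewrite E0. ring.
  - exists 1. split; [lra|]. intros w _.
    transitivity (cexp (z + (w - z))); [f_equal; ring|]. rewrite cexp_plus.
    unfold E. destruct (Ceq_dec _ _) as [e|n].
    + rewrite e, cexp_0. ring.
    + field. exact n.
Qed.

(** * The principal square root *)

Lemma csqrt_sqr (z : C) : (csqrt z * csqrt z)%C = z.
Proof.
  destruct z as [x y].
  assert (Hr : Rabs x <= Cmod (x, y)) by exact (re_le_Cmod (x, y)).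
  assert (Hx := Rabs_le_between x (Cmod (x, y))).
  assert (Hx2 : - Cmod (x, y) <= x <= Cmod (x, y)) by (apply Hx; exact Hr).
  assert (H2 : Cmod (x, y) * Cmod (x, y) = x * x + y * y).
  { unfold Cmod. rewrite sqrt_sqrt; simpl; nra. }
  unfold csqrt; simpl. set (M := Cmod (x, y)) in *.
  (* Twice this product is [|y|]; the sign chosen in [csqrt] turns it into [y]. *)
  assert (Hs : sqrt ((M + x) / 2) * sqrt ((M - x) / 2) = Rabs y / 2).
  { rewrite <- sqrt_mult by lra.
    replace ((M + x) / 2 * ((M - x) / 2)) with (Rsqr (y / 2)) by (unfold Rsqr; nra).
    rewrite sqrt_Rsqr_abs. unfold Rdiv. rewrite Rabs_mult, (Rabs_pos_eq (/ 2)) by lra. reflexivity. }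
  assert (Ha : sqrt ((M + x) / 2) * sqrt ((M + x) / 2) = (M + x) / 2) by (apply sqrt_sqrt; lra).
  assert (Hb : sqrt ((M - x) / 2) * sqrt ((M - x) / 2) = (M - x) / 2) by (apply sqrt_sqrt; lra).
  unfold Cmult; simpl.
  destruct (Rle_dec 0 y) as [Hy|Hy].
  - rewrite Rabs_pos_eq in Hs by lra. apply injective_projections; simpl; nra.
  - rewrite Rabs_left in Hs by lra. apply injective_projections; simpl; nra.
Qed.

Lemma csqrt_re_ge_0 (z : C) : 0 <= Re (csqrt z).
Proof. apply sqrt_pos. Qed.

Lemma csqrt_re_pos (z : C) : 0 < Re z -> 0 < Re (csqrt z).
Proof. intros H. apply sqrt_lt_R0. pose proof (Cmod_ge_0 z). unfold Re in *. lra. Qed.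

(** In the factorisation of the difference of squares, [csqrt z + w] has positive real part and can
    be divided out. *)
Lemma csqrt_unique (z w : C) : (w * w)%C = z -> 0 < Re w -> csqrt z = w.
Proof.
  intros Hw Hp. pose proof (csqrt_sqr z) as Hz. pose proof (csqrt_re_ge_0 z) as H0.
  assert (Hn : (csqrt z + w)%C <> RtoC 0).
  { intros E. apply (f_equal Re) in E. unfold Re in *. simpl in E. simpl in H0. lra. }
  assert (E : ((csqrt z - w) * (csqrt z + w) = 0)%C).
  { transitivity (csqrt z * csqrt z - w * w)%C; [ring|]. rewrite Hz, Hw. ring. }
  transitivity ((csqrt z - w) * (csqrt z + w) * / (csqrt z + w) + w)%C.
  - field. exact Hn.
  - rewrite E. ring.
Qed.

Lemma csqrt_neq_0 (z : C) : 0 < Re z -> csqrt z <> RtoC 0.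
Proof.
  intros H E. pose proof (csqrt_re_pos z H) as H0. rewrite E in H0. simpl in H0. lra.
Qed.

(** The slope is [/ (csqrt w + csqrt z)]. Principal roots have nonnegative real part, so the
    denominator has real part at least [Re (csqrt z) > 0] for every [w], on either side of the
    cut. *)
Lemma cdiff_csqrt (z : C) : 0 < Re z -> cdiff csqrt z (/ (2 * csqrt z)).
Proof.
  intros Hz. pose proof (csqrt_re_pos z Hz) as Hp. set (p := Re (csqrt z)) in *.
  assert (Hge : forall w, p <= Cmod (csqrt w + csqrt z)).
  { intros w. eapply Rle_trans; [|apply re_le_Cmod]. eapply Rle_trans; [|apply Rle_abs].
    pose proof (csqrt_re_ge_0 w). unfold p, Re in *. simpl. simpl in H. lra. }
  assert (Hn : forall w, (csqrt w + csqrt z)%C <> RtoC 0).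
  { intros w. apply Cmod_gt_0. specialize (Hge w). lra. }
  assert (Hd : forall w, (csqrt w - csqrt z)%C = (/ (csqrt w + csqrt z) * (w - z))%C).
  { intros w.
    transitivity (/ (csqrt w + csqrt z) * (csqrt w * csqrt w - csqrt z * csqrt z))%C;
      [field; apply Hn | rewrite !csqrt_sqr; reflexivity]. }
  assert (Hc : ccont csqrt z).
  { intros eps He. exists (eps * p). split; [nra|]. intros w Hw.
    rewrite Hd, Cmod_mult, Cmod_inv by apply Hn.
    apply Rmult_lt_reg_l with (Cmod (csqrt w + csqrt z)); [specialize (Hge w); lra|].
    rewrite <- Rmult_assoc, Rinv_r by (specialize (Hge w); lra).
    specialize (Hge w). nra. }
  exists (fun w => / (csqrt w + csqrt z))%C. split; [|split].
  - apply ccont_inv; [|apply Hn]. apply ccont_plus; [exact Hc | apply ccont_const].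
  - f_equal. ring.
  - exists 1. split; [lra|]. intros w _. rewrite <- Hd. ring.
Qed.

Lemma cdiff_mult_const (k : C) (F : C -> C) (z d : C) :
  cdiff F z d -> cdiff (fun w => k * F w)%C z (k * d)%C.
Proof.
  intros H. eapply cdiff_eq; [|apply cdiff_mult; [apply cdiff_const | exact H]]. simpl. ring.
Qed.

Lemma cdiff_cexp_lin (k z : C) : cdiff (fun w => cexp (k * w)) z (k * cexp (k * z))%C.
Proof.
  eapply cdiff_eq; [|apply (cdiff_comp cexp (fun w => k * w)%C);
    [apply cdiff_mult_const, cdiff_id | apply cdiff_cexp]]. simpl. ring.
Qed.

(** * Complex sine and cosine *)

Lemma Ci2 : (Ci * Ci = - (1))%C.
Proof. unfold Ci, Cmult, Copp, RtoC; simpl. f_equal; ring. Qed.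

Lemma Ci_neq_0 : Ci <> RtoC 0.
Proof. intros E. apply (f_equal snd) in E. simpl in E. lra. Qed.

Lemma C2_neq_0 : RtoC 2 <> RtoC 0.
Proof. intros E. apply RtoC_inj in E. lra. Qed.

Lemma csin_expand (z : C) :
  csin z = (/ (2 * Ci) * cexp (Ci * z) + (- / (2 * Ci)) * cexp ((- Ci) * z))%C.
Proof.
  unfold csin. replace (- (Ci * z))%C with ((- Ci) * z)%C by ring. unfold Cdiv. ring.
Qed.

Lemma ccos_expand (z : C) :
  ccos z = (/ 2 * cexp (Ci * z) + / 2 * cexp ((- Ci) * z))%C.
Proof.
  unfold ccos. replace (- (Ci * z))%C with ((- Ci) * z)%C by ring. unfold Cdiv. ring.
Qed.

Lemma cdiff_ext (F G : C -> C) (z d : C) : (forall w, F w = G w) -> cdiff F z d -> cdiff G z d.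
Proof.
  intros E [q [H1 [H2 H3]]]. exists q. repeat split; [assumption..|].
  refine (near_mono _ _ _ _ H3). intros w Hw. rewrite <- !E. exact Hw.
Qed.

Lemma cdiff_csin (z : C) : cdiff csin z (ccos z).
Proof.
  eapply cdiff_ext; [intros w; symmetry; apply csin_expand|].
  eapply cdiff_eq; [|apply cdiff_plus; apply cdiff_mult_const, cdiff_cexp_lin].
  rewrite ccos_expand. field; repeat split; first [apply Ci_neq_0 | apply C2_neq_0].
Qed.

Lemma holo_ccos (z : C) : holo ccos z.
Proof.
  eexists. eapply cdiff_ext; [intros w; symmetry; apply ccos_expand|].
  apply cdiff_plus; apply cdiff_mult_const, cdiff_cexp_lin.
Qed.

(** A zero means [exp (i z) = exp (- i z)]: equal moduli force [Im z = 0], and then the imaginary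
    parts give [sin (Re z) = 0]. *)
Lemma csin_zero (z : C) : csin z = RtoC 0 -> sin (Re z) = 0 /\ Im z = 0.
Proof.
  intros H.
  assert (E : cexp (Ci * z) = cexp (- (Ci * z))).
  { transitivity (csin z * (2 * Ci) + cexp (- (Ci * z)))%C.
    - unfold csin. field; repeat split; first [apply Ci_neq_0 | apply C2_neq_0].
    - rewrite H. ring. }
  assert (Ey : Im z = 0).
  { pose proof (f_equal Cmod E) as E2. rewrite !Cmod_cexp in E2. apply exp_inv in E2.
    destruct z as [x y]. unfold Re, Im in *; simpl in *. lra. }
  split; [|exact Ey].
  apply (f_equal snd) in E. destruct z as [x y]. unfold cexp, Re, Im in *; simpl in *. subst y.
  replace (- (0 * x - 1 * 0)) with 0 in E by ring. replace (0 * x - 1 * 0) with 0 in E by ring.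
  replace (0 * 0 + 1 * x) with x in E by ring. rewrite exp_0, sin_neg in E. lra.
Qed.

(** * Poles and residues of the integrand *)

Lemma Cinv_neq_0 (z : C) : z <> RtoC 0 -> (/ z)%C <> RtoC 0.
Proof.
  intros H E. assert (H1 : (/ z * z = 1)%C) by (field; exact H).
  rewrite E in H1. apply (f_equal fst) in H1. simpl in H1. lra.
Qed.

Definition fnum (T x : R) (u : C) : C :=
  (RtoC (x / PI) * / csqrt u * cexp (csqrt u - RtoC T))%C.

Definition fden (T x : R) (u : C) : C := (cexp (2 * (csqrt u - RtoC T)) + RtoC x)%C.

(** The value of [Re (sqrt u)] at the poles of [f], where [exp (sqrt u - T)] has modulus [sqrt x].
    The half-height of Gamma is [2 * PI * flen T x]. *)
Definition flen (T x : R) : R := T + / 2 * ln x.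

(* The poles of [f] enclosed by Gamma ([s = 1] and [s = -1]): the squares of
   [flen T x + i s PI / 2]. *)
Definition fpole (T x s : R) : C := (flen T x ^ 2 - PI ^ 2 / 4, s * (PI * flen T x)).

Lemma holo_csqrt (u : C) : 0 < Re u -> holo csqrt u.
Proof. intros H. eexists. apply cdiff_csqrt, H. Qed.

Lemma holo_cexp (u : C) : holo cexp u.
Proof. eexists. apply cdiff_cexp. Qed.

Lemma holo_fnum (T x : R) (u : C) : 0 < Re u -> holo (fnum T x) u.
Proof.
  intros H. apply holo_mult.
  - apply holo_mult; [apply holo_const|]. apply holo_inv; [apply holo_csqrt, H | apply csqrt_neq_0, H].
  - apply (holo_comp cexp (fun u => csqrt u - RtoC T)%C); [|apply holo_cexp].
    apply holo_plus; [apply holo_csqrt, H | apply holo_const].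
Qed.

Lemma cdiff_fden (T x : R) (u : C) : 0 < Re u ->
  cdiff (fden T x) u (cexp (2 * (csqrt u - RtoC T)) / csqrt u)%C.
Proof.
  intros H. unfold fden. pose proof (csqrt_neq_0 u H) as Hn.
  eapply cdiff_eq; [|apply cdiff_plus; [|apply cdiff_const]].
  2: { apply (cdiff_comp cexp (fun u => 2 * (csqrt u - RtoC T))%C).
       - apply cdiff_mult_const, cdiff_plus; [apply cdiff_csqrt, H | apply cdiff_const].
       - apply cdiff_cexp. }
  cbv beta. field. exact Hn.
Qed.

Lemma holo_f (T x : R) (u : C) : 0 < Re u -> fden T x u <> RtoC 0 ->
  holo (fun u => f_fun T u x) u.
Proof.
  intros H Hn. apply (holo_mult (fnum T x) (fun u => / fden T x u)%C).
  - apply holo_fnum, H.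
  - apply holo_inv; [eexists; apply cdiff_fden, H | exact Hn].
Qed.

Lemma sin_zero_cases (t : R) : sin t = 0 -> cos t < 0 -> Rabs t <= 2 * PI -> t = PI \/ t = - PI.
Proof.
  intros Hs Hc Ht. destruct (sin_eq_0_0 t Hs) as [k Hk]. subst t.
  pose proof PI_RGT_0 as HP.
  assert (Hk2 : Rabs (IZR k) <= 2).
  { rewrite Rabs_mult, (Rabs_pos_eq PI) in Ht by lra. nra. }
  apply Rabs_le_between in Hk2. destruct Hk2 as [H1 H2].
  assert (A1 : (-2 <= k)%Z) by (apply le_IZR; exact H1).
  assert (A2 : (k <= 2)%Z) by (apply le_IZR; exact H2).
  assert (D : k = (-2)%Z \/ k = (-1)%Z \/ k = 0%Z \/ k = 1%Z \/ k = 2%Z) by lia.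
  destruct D as [E|[E|[E|[E|E]]]]; subst k.
  - exfalso. replace (-2 * PI) with (- (2 * PI)) in Hc by ring. rewrite cos_neg, cos_2PI in Hc. lra.
  - right. lra.
  - exfalso. rewrite Rmult_0_l, cos_0 in Hc. lra.
  - left. lra.
  - exfalso. rewrite cos_2PI in Hc. lra.
Qed.

(** Writing [sqrt u = p + i q], a zero forces [p = flen T x] and [cos (2 * q) = -1]. Since
    [Im u = p * (2 * q)], the height bound reads [|2 * q| <= 2 * PI] and leaves only [PI] and
    [- PI]. *)
Lemma fden_zero (T x : R) (u : C) : 0 < x -> 0 < Re u -> 0 < flen T x ->
  Rabs (Im u) <= 2 * PI * flen T x -> fden T x u = RtoC 0 ->
  u = fpole T x 1 \/ u = fpole T x (-1).
Proof.
  intros Hx Hu HL Hi HD. pose proof (csqrt_sqr u) as Hsq. pose proof (csqrt_re_pos u Hu) as Hp.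
  unfold fden in HD. destruct (csqrt u) as [p q]. unfold Re in Hp; simpl in Hp.
  pose proof (f_equal fst HD) as H1. pose proof (f_equal snd HD) as H2.
  unfold cexp in H1, H2. simpl in H1, H2.
  replace (2 * (p + - T) - 0 * (q + - 0)) with (2 * (p - T)) in * by ring.
  replace (2 * (q + - 0) + 0 * (p + - T)) with (2 * q) in * by ring.
  pose proof (exp_pos (2 * (p - T))) as He.
  set (E := exp (2 * (p - T))) in *.
  assert (Hs : sin (2 * q) = 0).
  { apply Rmult_eq_reg_l with E; lra. }
  assert (Hc : cos (2 * q) < 0).
  { apply Rmult_lt_reg_l with E; lra. }
  assert (Hc1 : cos (2 * q) = - (1)).
  { pose proof (sin2_cos2 (2 * q)) as H. rewrite Hs in H. unfold Rsqr in H. nra. }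
  assert (HE : E = x) by (rewrite Hc1 in H1; lra).
  assert (HpL : p = flen T x).
  { unfold flen. rewrite <- HE. unfold E. rewrite ln_exp. field. }
  rewrite <- Hsq in Hi |- *. unfold Im in Hi; simpl in Hi.
  assert (Hq : Rabs (2 * q) <= 2 * PI).
  { rewrite <- HpL in *. replace (p * q + q * p) with (p * (2 * q)) in Hi by ring.
    rewrite Rabs_mult, (Rabs_pos_eq p) in Hi by lra.
    apply Rmult_le_reg_l with p; lra. }
  destruct (sin_zero_cases _ Hs Hc Hq) as [Eq|Eq]; [left|right];
    unfold fpole, Cmult; simpl; rewrite HpL; apply injective_projections; simpl;
    [replace q with (PI / 2) by lra | replace q with (PI / 2) by lra
    | replace q with (- (PI / 2)) by lra | replace q with (- (PI / 2)) by lra]; field.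
Qed.

Lemma csqrt_fpole (T x s : R) : s = 1 \/ s = -1 -> 0 < flen T x ->
  csqrt (fpole T x s) = (flen T x, s * (PI / 2)).
Proof.
  intros Hs HL. apply csqrt_unique; [|exact HL].
  unfold fpole, Cmult. apply injective_projections; simpl;
    destruct Hs; subst s; field.
Qed.

Lemma exp_flen (T x : R) : 0 < x -> exp (flen T x - T) = sqrt x.
Proof.
  intros Hx. replace (flen T x - T) with (/ 2 * ln x) by (unfold flen; ring).
  rewrite <- Rpower_sqrt by exact Hx. reflexivity.
Qed.

Lemma cexp_at_fpole (T x s : R) : s = 1 \/ s = -1 -> 0 < x -> 0 < flen T x ->
  cexp (csqrt (fpole T x s) - RtoC T) = (0, s * sqrt x).
Proof.
  intros Hs Hx HL. rewrite csqrt_fpole by assumption. unfold cexp, Re, Im; simpl.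
  replace (flen T x + - T) with (flen T x - T) by ring.
  replace (s * (PI / 2) + - 0) with (s * (PI / 2)) by ring.
  rewrite exp_flen by exact Hx.
  destruct Hs; subst s.
  - rewrite !Rmult_1_l, cos_PI2, sin_PI2. f_equal; ring.
  - replace (-1 * (PI / 2)) with (- (PI / 2)) by ring.
    rewrite cos_neg, sin_neg, cos_PI2, sin_PI2. f_equal; ring.
Qed.

Lemma cexp2_at_fpole (T x s : R) : s = 1 \/ s = -1 -> 0 < x -> 0 < flen T x ->
  cexp (2 * (csqrt (fpole T x s) - RtoC T)) = (- RtoC x)%C.
Proof.
  intros Hs Hx HL.
  replace (2 * (csqrt (fpole T x s) - RtoC T))%C
    with ((csqrt (fpole T x s) - RtoC T) + (csqrt (fpole T x s) - RtoC T))%C by ring.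
  rewrite cexp_plus, cexp_at_fpole by assumption.
  pose proof (sqrt_sqrt x (Rlt_le _ _ Hx)) as H.
  unfold Cmult, Copp, RtoC; simpl. f_equal; [|ring].
  replace (0 * 0 - s * sqrt x * (s * sqrt x)) with (- (s * s) * (sqrt x * sqrt x)) by ring.
  rewrite H. destruct Hs; subst s; ring.
Qed.

Lemma has_residue_ext (F G : C -> C) (c rho : C) :
  (forall w, F w = G w) -> has_residue F c rho -> has_residue G c rho.
Proof.
  intros E H eps He. refine (near_mono _ _ _ _ (H eps He)). intros w Hw. rewrite <- E. exact Hw.
Qed.

(** The factor [1 / sqrt u] of the numerator cancels against the one in the derivative of the
    denominator, which leaves [- i s sqrt x / PI]. The continuous factor [g] will be both the
    constant 1 and [m]. *)
Lemma f_residue (T x s : R) (g : C -> C) : s = 1 \/ s = -1 -> 0 < x -> 0 < flen T x ->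
  0 < Re (fpole T x s) -> ccont g (fpole T x s) ->
  has_residue (fun u => f_fun T u x * g u)%C (fpole T x s)
    ((0, (- (s * sqrt x / PI))%R) * g (fpole T x s))%C.
Proof.
  intros Hs Hx HL Hp Hg. set (c := fpole T x s) in *.
  pose proof (csqrt_neq_0 c Hp) as Hn.
  assert (Hx0 : RtoC x <> RtoC 0) by (intros E; apply RtoC_inj in E; lra).
  assert (HPI : RtoC PI <> RtoC 0) by (intros E; apply RtoC_inj in E; pose proof PI_RGT_0; lra).
  apply (has_residue_ext (fun u => (fnum T x u * g u) / fden T x u)%C).
  { intros w. unfold f_fun, fnum, fden, Cdiv. ring. }
  pose proof (cexp2_at_fpole T x s Hs Hx HL) as E2. fold c in E2.
  pose proof (cexp_at_fpole T x s Hs Hx HL) as E1. fold c in E1.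
  replace ((0, (- (s * sqrt x / PI))%R) * g c)%C
    with ((fnum T x c * g c) / (cexp (2 * (csqrt c - RtoC T)) / csqrt c))%C.
  - apply (has_residue_quot (fun u => fnum T x u * g u)%C (fden T x)).
    + apply ccont_mult; [apply holo_ccont, holo_fnum, Hp | exact Hg].
    + apply cdiff_fden, Hp.
    + unfold fden. rewrite E2. ring.
    + rewrite E2. apply Cmult_neq_0; [|apply Cinv_neq_0, Hn].
      intros E. apply Hx0. replace (RtoC x) with (- (- RtoC x))%C by ring. rewrite E. ring.
  - rewrite E2. unfold fnum. rewrite E1, RtoC_div by exact PI_neq0.
    replace ((0, - (s * sqrt x / PI))%R : C) with (- ((0, (s * sqrt x)%R) / RtoC PI))%C.
    + field. repeat split; assumption.
    + unfold Cdiv. rewrite <- RtoC_inv by exact PI_neq0. unfold Copp, Cmult, RtoC; simpl. f_equal; unfold Rdiv; ring.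
Qed.

Lemma csin_scaled_zero (h : R) (u : C) : 0 < h -> csin (RtoC PI * u / RtoC h) = RtoC 0 ->
  exists k : Z, u = (IZR k * h, 0).
Proof.
  intros Hh H. pose proof PI_RGT_0 as HP. apply csin_zero in H. destruct H as [H1 H2].
  replace (RtoC PI * u / RtoC h)%C with ((PI * fst u / h)%R, (PI * snd u / h)%R) in *.
  - unfold Re, Im in *; simpl in *. destruct (sin_eq_0_0 _ H1) as [k Hk]. exists k.
    destruct u as [a b]; simpl in *. f_equal.
    + apply Rmult_eq_reg_l with (PI / h).
      * transitivity (PI * a / h); [field; lra|]. rewrite Hk. field. lra.
      * apply Rgt_not_eq, Rdiv_lt_0_compat; lra.
    + apply Rmult_eq_reg_l with (PI / h).
      * transitivity (PI * b / h); [field; lra|]. rewrite H2. ring.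
      * apply Rgt_not_eq, Rdiv_lt_0_compat; lra.
  - unfold Cdiv. rewrite <- RtoC_inv by lra. destruct u. unfold Cmult, RtoC; simpl.
    apply injective_projections; simpl; unfold Rdiv; ring.
Qed.

Lemma cdiff_scaled (h : R) (u : C) :
  cdiff (fun u => RtoC PI * u / RtoC h)%C u (RtoC PI / RtoC h)%C.
Proof.
  eapply cdiff_ext; [|eapply cdiff_eq; [|apply (cdiff_mult_const (RtoC PI / RtoC h)), cdiff_id]].
  - intros w. unfold Cdiv. ring.
  - ring.
Qed.

Lemma holo_m (h : R) (u : C) : csin (RtoC PI * u / RtoC h) <> RtoC 0 -> holo (m_fun h) u.
Proof.
  intros H. apply holo_mult; [apply holo_const|].
  apply (holo_mult (fun u => ccos (RtoC PI * u / RtoC h)) (fun u => / csin (RtoC PI * u / RtoC h))%C).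
  - apply (holo_comp ccos (fun u => RtoC PI * u / RtoC h)%C); [eexists; apply cdiff_scaled | apply holo_ccos].
  - apply holo_inv; [|exact H].
    apply (holo_comp csin (fun u => RtoC PI * u / RtoC h)%C); eexists; [apply cdiff_scaled | apply cdiff_csin].
Qed.

(** The cotangent has residue 1 at multiples of [PI], rescaled here by [h / PI]. Multiplied by
    [2 * PI * Ci], the value becomes [h * g], one term of the trapezoidal sum. *)
Lemma m_residue (h : R) (k : Z) (g : C -> C) : 0 < h -> ccont g (IZR k * h, 0) ->
  has_residue (fun u => g u * m_fun h u)%C (IZR k * h, 0)
    (g (IZR k * h, 0)%R * (- (Ci / 2)) * (RtoC h / RtoC PI))%C.
Proof.
  intros Hh Hg. pose proof PI_RGT_0 as HP. set (c := (IZR k * h, 0) : C) in *.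
  set (A := fun u : C => (RtoC PI * u / RtoC h)%C).
  assert (Hh0 : RtoC h <> RtoC 0) by (intros E; apply RtoC_inj in E; lra).
  assert (HPI : RtoC PI <> RtoC 0) by (intros E; apply RtoC_inj in E; lra).
  assert (HA : A c = ((IZR k * PI)%R, 0)).
  { unfold A, c, Cdiv. rewrite <- RtoC_inv by lra. unfold Cmult, RtoC; simpl.
    apply injective_projections; simpl; field; lra. }
  assert (Hsin : csin (A c) = RtoC 0).
  { rewrite HA. unfold csin, cexp, Re, Im; simpl.
    replace (0 * (IZR k * PI) - 1 * 0) with 0 by ring.
    replace (0 * 0 + 1 * (IZR k * PI)) with (IZR k * PI) by ring.
    rewrite Ropp_0, exp_0, cos_neg, sin_neg.
    rewrite (sin_eq_0_1 (IZR k * PI)) by (exists k; reflexivity).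
    unfold Cdiv. match goal with |- (?a * _ = _)%C => replace a with (RtoC 0) end; [ring|].
    unfold Cminus, Cplus, Copp, RtoC; simpl. f_equal; ring. }
  assert (Hcos : ccos (A c) <> RtoC 0).
  { intros E. apply (cexp_neq_0 (Ci * A c)).
    (* Cosine and sine cannot vanish together, since [cos + i sin] is an exponential. *)
    transitivity (ccos (A c) + Ci * csin (A c))%C.
    - unfold ccos, csin. field. repeat split; first [apply Ci_neq_0 | apply C2_neq_0].
    - rewrite E, Hsin. ring. }
  apply (has_residue_ext (fun u => (g u * (- (Ci / 2)) * ccos (A u)) / csin (A u))%C).
  { intros w. unfold m_fun, ccot, A, Cdiv. ring. }
  replace (g c * - (Ci / 2) * (RtoC h / RtoC PI))%C
    with (g c * - (Ci / 2) * ccos (A c) / (ccos (A c) * (RtoC PI / RtoC h)))%C.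
  - apply (has_residue_quot (fun u => g u * - (Ci / 2) * ccos (A u))%C).
    + apply ccont_mult; [apply ccont_mult; [exact Hg | apply ccont_const]|].
      apply holo_ccont, (holo_comp ccos A); [eexists; apply cdiff_scaled | apply holo_ccos].
    + apply (cdiff_comp csin A); [apply cdiff_scaled | apply cdiff_csin].
    + exact Hsin.
    + apply Cmult_neq_0; [exact Hcos|]. apply Cmult_neq_0; [exact HPI | apply Cinv_neq_0, Hh0].
  - field. repeat split; try assumption; apply C2_neq_0.
Qed.

Lemma delta_decay_aux (A B : C) (K : R) :
  (Cmod A <= K / 2 * Cmod B) -> K <= 1 -> B <> RtoC 0 ->
  Cmod (A / (B - A))%C <= K /\ (B - A)%C <> RtoC 0.
Proof.
  intros H HK HB. assert (H0 : 0 < Cmod B) by (apply Cmod_gt_0, HB).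
  assert (Hd : Cmod B / 2 <= Cmod (B - A)).
  { pose proof (Cmod_triangle (B - A) A) as H1. replace (B - A + A)%C with B in H1 by ring. nra. }
  assert (Hn : (B - A)%C <> RtoC 0) by (apply Cmod_gt_0; lra).
  split; [|exact Hn]. rewrite Cmod_div by exact Hn.
  apply Rmult_le_reg_r with (Cmod (B - A)); [lra|].
  unfold Rdiv. rewrite Rmult_assoc, Rinv_l, Rmult_1_r by lra.
  pose proof (Cmod_ge_0 A). nra.
Qed.

(** * Evaluation of the contour integral *)

(** A partial sum of Leibniz's series, sharp enough for [PI ^ 2 / 4 < 3] and [PI * sqrt 2 <= 5]. *)
Lemma PI_le_334 : PI <= 334 / 100.
Proof.
  pose proof (PI_ineq 2) as [_ H]. unfold tg_alt, PI_tg in H. simpl in H. lra.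
Qed.

(** In these forms [delta] is a ratio of exponentials whose numerator is the decaying one: [A] in
    the upper half plane, [B] in the lower. This is why [mu] is [-1/2] above the axis and [1/2]
    below. *)
Lemma m_shifted (h : R) (u : C) :
  let A := cexp (Ci * (RtoC PI * u / RtoC h)) in
  let B := cexp (- (Ci * (RtoC PI * u / RtoC h))) in
  (B - A)%C <> RtoC 0 ->
  (RtoC (-1/2) - m_fun h u = A / (B - A))%C /\ (RtoC (1/2) - m_fun h u = - (B / (A - B)))%C.
Proof.
  intros A B Hn. unfold m_fun, ccot, ccos, csin. fold A B.
  assert (Hn2 : (A - B)%C <> RtoC 0).
  { intros E. apply Hn. transitivity (- (A - B))%C; [ring | rewrite E; ring]. }
  assert (E1 : (- (Ci / 2) * ((A + B) / 2 / ((A - B) / (2 * Ci))) = / 2 * (A + B) / (A - B))%C).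
  { transitivity (- (Ci * Ci) * (/ 2 * (A + B) / (A - B)))%C.
    - field. repeat split; first [exact Hn2 | apply Ci_neq_0].
    - rewrite Ci2. ring. }
  rewrite E1.
  replace (RtoC (-1/2)) with (- / 2)%C by
    (rewrite <- RtoC_inv by lra; unfold Copp, RtoC; simpl; f_equal; field).
  replace (RtoC (1/2)) with (/ 2)%C by
    (rewrite <- RtoC_inv by lra; unfold RtoC; simpl; f_equal; field).
  split; field; repeat split; first [exact Hn2 | exact Hn | split; assumption].
Qed.

Lemma exp_neg_le_half (L : R) : 1 <= L -> 2 * exp (- L) <= 1.
Proof.
  intros HL. pose proof (exp_ineq1_le L) as H. pose proof (exp_pos (- L)) as H0.
  assert (H1 : exp (- L) * exp L = 1) by (rewrite <- exp_plus, Rplus_opp_l, exp_0; reflexivity).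
  nra.
Qed.

(** At height [PI * L] the two exponentials have moduli [exp (- L / 2)] and [exp (L / 2)], thanks to
    [h = 2 * PI ^ 2]. Their quotient is [exp (- L)], and the subtraction in the denominator costs at
    most a factor 2. *)
Lemma delta_fpole (T x : R) : 1 <= flen T x ->
  Cmod (RtoC (-1/2) - m_fun (2 * PI ^ 2) (fpole T x 1)) <= 2 * exp (- flen T x) /\
  Cmod (RtoC (1/2) - m_fun (2 * PI ^ 2) (fpole T x (-1))) <= 2 * exp (- flen T x).
Proof.
  intros HL. pose proof PI_RGT_0 as HP. pose proof (exp_neg_le_half _ HL) as HK.
  assert (HM : forall s,
     Cmod (cexp (Ci * (RtoC PI * fpole T x s / RtoC (2 * PI ^ 2)))) = exp (- (s * (flen T x / 2))) /\
     Cmod (cexp (- (Ci * (RtoC PI * fpole T x s / RtoC (2 * PI ^ 2))))) = exp (s * (flen T x / 2))).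
  { intros s. rewrite !Cmod_cexp.
    replace (RtoC PI * fpole T x s / RtoC (2 * PI ^ 2))%C
      with (((flen T x ^ 2 - PI ^ 2 / 4) / (2 * PI))%R, (s * (flen T x / 2))%R).
    - split; f_equal; unfold Re; simpl; ring.
    - unfold Cdiv. rewrite <- RtoC_inv by (apply Rgt_not_eq; nra). unfold fpole, Cmult, RtoC; simpl.
      f_equal; field; lra. }
  set (L := flen T x) in *.
  assert (HE : exp (- (L / 2)) = 2 * exp (- L) / 2 * exp (L / 2)).
  { replace (2 * exp (- L) / 2 * exp (L / 2)) with (exp (- L) * exp (L / 2)) by field.
    rewrite <- exp_plus. f_equal. field. }
  split.
  - destruct (HM 1) as [M1 M2]. rewrite Rmult_1_l in M1, M2.
    edestruct delta_decay_aux as [H1 H2].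
    2: exact HK. 3: { rewrite (proj1 (m_shifted _ _ H2)). exact H1. }
    + rewrite M1, M2, HE. lra.
    + apply cexp_neq_0.
  - destruct (HM (-1)) as [M1 M2].
    replace (- (-1 * (L / 2))) with (L / 2) in M1 by ring.
    replace (-1 * (L / 2)) with (- (L / 2)) in M2 by ring.
    edestruct (delta_decay_aux (cexp (- (Ci * (RtoC PI * fpole T x (-1) / RtoC (2 * PI ^ 2)))))
      (cexp (Ci * (RtoC PI * fpole T x (-1) / RtoC (2 * PI ^ 2))))) as [H1 H2].
    2: exact HK. 3: { rewrite (proj2 (m_shifted _ (fpole T x (-1)) ltac:(intros E; apply H2;
       match goal with |- (?a - ?b)%C = _ => transitivity (- (b - a))%C; [ring | rewrite E; ring] end))).
       rewrite Cmod_opp. exact H1. }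
    + rewrite M1, M2, HE. lra.
    + apply cexp_neq_0.
Qed.

Definition freal (T x u : R) : R :=
  x / PI * / sqrt u * exp (sqrt u - T) / (exp (2 * (sqrt u - T)) + x).

Lemma cexp_RtoC (t : R) : cexp (RtoC t) = RtoC (exp t).
Proof. unfold cexp, RtoC, Re, Im; simpl. rewrite cos_0, sin_0. f_equal; ring. Qed.

Lemma f_fun_real (T x u : R) : 0 < x -> 0 < u -> f_fun T (u, 0) x = RtoC (freal T x u).
Proof.
  intros Hx Hu. pose proof (sqrt_lt_R0 u Hu) as Hs.
  assert (E : csqrt (u, 0) = RtoC (sqrt u)).
  { apply csqrt_unique; [|exact Hs]. rewrite <- RtoC_mult, sqrt_sqrt by lra. reflexivity. }
  pose proof (exp_pos (2 * (sqrt u - T))) as He.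
  unfold f_fun, freal. rewrite E, <- RtoC_minus, <- RtoC_mult, !cexp_RtoC.
  pose proof PI_RGT_0.
  rewrite (RtoC_div _ (exp (2 * (sqrt u - T)) + x)), !RtoC_mult, (RtoC_inv (sqrt u)),
    RtoC_plus by lra. reflexivity.
Qed.

(** The abscissas [n * h + 1] lie strictly between consecutive poles of [m]; the vertical sides of
    Gamma and the cuts between nodes are all of this form. *)
Lemma not_multiple (h : R) (n : nat) (k : Z) : 1 < h -> INR n * h + 1 <> IZR k * h.
Proof.
  intros Hh E. rewrite INR_IZR_INZ in E.
  assert (E2 : IZR (k - Z.of_nat n) * h = 1) by (rewrite minus_IZR; lra).
  set (d := (k - Z.of_nat n)%Z) in *.
  destruct (Z.le_gt_cases d 0) as [H|H].
  - apply IZR_le in H. nra.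
  - assert (H1 : (1 <= d)%Z) by lia. apply IZR_le in H1. nra.
Qed.

Lemma f_holo_region (T x : R) (u : C) : 0 < x -> 2 <= flen T x -> 1 <= fst u ->
  Rabs (snd u) <= 2 * PI * flen T x -> u <> fpole T x 1 -> u <> fpole T x (-1) ->
  holo (fun u => f_fun T u x) u.
Proof.
  intros Hx HL H1 H2 H3 H4. apply holo_f; [unfold Re; lra|].
  intros E. destruct (fden_zero T x u) as [H|H]; try assumption; try lra; [unfold Re; lra | |];
  contradiction.
Qed.

Lemma m_holo_off_axis (h : R) (u : C) : 0 < h -> snd u <> 0 -> holo (m_fun h) u.
Proof.
  intros Hh Hu. apply holo_m. intros E. destruct (csin_scaled_zero h u Hh E) as [k Hk].
  apply Hu. rewrite Hk. reflexivity.
Qed.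

Section Contour.
(** [HT] puts the right side of Gamma at [n * h + 1], just beyond node [n]; [HL] is the form that
    [exp (4 - 2 * T) <= x] takes for the position of the poles. *)
Context (T x h : R) (n : nat) (Hx : 0 < x <= 1) (HL : 2 <= flen T x) (Hh : 1 < h)
  (HT : 4 * T ^ 2 = INR n * h).

Lemma fpole_re : 1 < flen T x ^ 2 - PI ^ 2 / 4 < 4 * T ^ 2 + 1.
Proof.
  pose proof PI_le_334. pose proof PI_RGT_0.
  assert (HLT : flen T x <= T).
  { unfold flen. assert (ln x <= 0); [|lra]. rewrite <- ln_1.
    destruct (Req_dec x 1) as [->|]; [lra|]. left. apply ln_increasing; lra. }
  split; nra.
Qed.

Lemma flen_pi : 0 < PI * flen T x.
Proof. pose proof PI_RGT_0. nra. Qed.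

Lemma m_holo_cut (k : nat) (t : R) : holo (m_fun h) (INR k * h + 1, t).
Proof.
  apply holo_m. intros E. destruct (csin_scaled_zero h _ ltac:(lra) E) as [i Hi].
  apply (f_equal fst) in Hi. simpl in Hi. exact (not_multiple h k i Hh Hi).
Qed.

Lemma f_holo_cut_1 (t : R) : Rabs t <= 2 * PI * flen T x -> holo (fun u => f_fun T u x) (1, t).
Proof.
  pose proof fpole_re. intros Ht. apply f_holo_region; simpl; try lra;
    intros E; apply (f_equal fst) in E; simpl in E; lra.
Qed.

Lemma f_holo_cut_X (t : R) : Rabs t <= 2 * PI * flen T x ->
  holo (fun u => f_fun T u x) (4 * T ^ 2 + 1, t).
Proof.
  pose proof fpole_re. intros Ht. apply f_holo_region; simpl; try nra;
    intros E; apply (f_equal fst) in E; simpl in E; lra.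
Qed.

Lemma f_holo_strip (u : C) : 1 <= fst u -> Rabs (snd u) <= PI * flen T x / 2 ->
  holo (fun u => f_fun T u x) u.
Proof.
  pose proof flen_pi. intros H1 H2. apply f_holo_region; try lra;
    intros E; rewrite E in H2; unfold fpole in H2; simpl snd in H2; rewrite Rabs_mult in H2;
    rewrite (Rabs_pos_eq (PI * flen T x)) in H2 by lra;
    [rewrite Rabs_R1 in H2 | rewrite Rabs_left in H2 by lra]; lra.
Qed.

(* One rectangle [k h + 1 <= Re u <= (k + 1) h + 1] per node: the low strip contains no pole of [f]. *)
Lemma rect_int_strip (k : nat) :
  rect_int (fun u => f_fun T u x * m_fun h u)%C 1 (INR k * h + 1) (- (PI * flen T x / 2)) (PI * flen T x / 2)
  = RtoC (sum_1_to k (fun j => h * freal T x (INR j * h))).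
Proof.
  pose proof flen_pi as Hb0. pose proof PI_RGT_0 as HPI.
  set (b := PI * flen T x / 2). assert (Hb : 0 < b) by (unfold b; lra).
  assert (Hf : forall u : C, 1 <= fst u -> - b <= snd u <= b -> holo (fun u => f_fun T u x) u).
  { intros u H1 H2. apply f_holo_strip; [exact H1|]. fold b. apply Rabs_le. lra. }
  assert (Hoff : forall u : C, 1 <= fst u -> - b <= snd u <= b -> snd u <> 0 ->
    holo (fun u => f_fun T u x * m_fun h u)%C u).
  { intros u H1 H2 H3. apply holo_mult; [apply Hf; assumption | apply m_holo_off_axis; lra]. }
  induction k as [|k IH].
  - simpl. apply goursat; [lra | lra |]. intros u H1 H2.
    apply holo_mult; [apply Hf; lra|]. destruct u as [p q]. simpl in *.
    replace p with (INR 0 * h + 1) by (simpl; lra). apply m_holo_cut.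
  - assert (Hk : 0 <= INR k) by apply pos_INR.
    assert (Hkh : 0 <= INR k * h) by nra.
    rewrite (rect_int_split_x _ 1 (INR k * h + 1) (INR (S k) * h + 1)).
    2: { rewrite S_INR. nra. } 2: lra.
    2,3: intros t Ht; apply holo_ccont, Hoff; simpl; lra.
    rewrite IH. cbn [sum_1_to]. rewrite RtoC_plus. f_equal.
    set (c := INR (S k) * h).
    assert (Ec : c = IZR (Z.of_nat (S k)) * h) by (unfold c; rewrite INR_IZR_INZ; reflexivity).
    assert (Hc : INR k * h + 1 < c) by (unfold c; rewrite S_INR; nra).
    assert (Hc1 : 1 < c) by nra.
    rewrite (rect_int_simple_pole _ _ _ _ _ c 0 (f_fun T (c, 0)%R x * (- (Ci / 2)) * (RtoC h / RtoC PI))%C).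
    + rewrite f_fun_real by lra. rewrite RtoC_mult.
      transitivity (- (Ci * Ci) * (RtoC h * RtoC (freal T x c)))%C.
      * field. intros E. apply RtoC_inj in E. lra.
      * rewrite Ci2. ring.
    + lra.
    + lra.
    + intros u H1 H2 H3. apply holo_mult; [apply Hf; lra|].
      apply holo_m. intros E. destruct (csin_scaled_zero h u ltac:(lra) E) as [i Hi].
      apply H3. rewrite Hi, Ec. f_equal. f_equal. f_equal.
      rewrite Hi in H1. simpl fst in H1.
      (* A zero [i * h] of the sine between the two cuts satisfies [k < i < k + 2], so it is the
         node [c]. *)
      assert (A1 : INR k < IZR i) by nra.
      assert (A2 : IZR i < INR k + 2).
      { destruct H1 as [_ H1]. unfold c in H1. rewrite S_INR in H1. nra. }
      rewrite INR_IZR_INZ in A1, A2. rewrite <- plus_IZR in A2.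
      apply lt_IZR in A1. apply lt_IZR in A2. lia.
    + rewrite Ec. apply (m_residue h (Z.of_nat (S k)) (fun u => f_fun T u x)); [lra|].
      rewrite <- Ec. apply holo_ccont, Hf; simpl; lra.
Qed.

(** The residue of [f] at [fpole T x s]; it does not depend on [T]. *)
Definition fres (s : R) : C := (0, - (s * sqrt x / PI)).

(** The condition on [t] keeps the conjugate pole outside. With [g = m] the rectangle stays off the
    axis; with [g = 1] it may touch it. *)
Lemma rect_int_half_pole (g : C -> C) (s y0 y1 : R) : s = 1 \/ s = -1 ->
  - (2 * PI * flen T x) <= y0 -> y0 < s * (PI * flen T x) < y1 -> y1 <= 2 * PI * flen T x ->
  (forall t, y0 <= t <= y1 -> t <> - s * (PI * flen T x)) ->
  (forall u : C, 1 <= fst u -> y0 <= snd u <= y1 -> holo g u) ->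
  rect_int (fun u => f_fun T u x * g u)%C 1 (4 * T ^ 2 + 1) y0 y1
  = (2 * PI * Ci * (fres s * g (fpole T x s)))%C.
Proof.
  intros Hs H0 Hy H1 Ho Hg. pose proof fpole_re as Hp. pose proof flen_pi as Hb0.
  assert (Hpp : forall v, fpole T x v = (flen T x ^ 2 - PI ^ 2 / 4, v * (PI * flen T x))) by reflexivity.
  apply (rect_int_simple_pole _ 1 (4 * T ^ 2 + 1) y0 y1 (flen T x ^ 2 - PI ^ 2 / 4) (s * (PI * flen T x))).
  - lra.
  - lra.
  - intros u U1 U2 U3. apply holo_mult; [|apply Hg; lra].
    assert (Hn : u <> fpole T x (- s)).
    { intros E. apply (Ho (snd u) U2). rewrite E. reflexivity. }
    assert (U4 : Rabs (snd u) <= 2 * PI * flen T x) by (apply Rabs_le; lra).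
    apply f_holo_region; try lra; destruct Hs; subst s; try exact U3;
      try (intros E; apply Hn; rewrite E; f_equal; lra).
  - apply (f_residue T x s g); [exact Hs | lra | lra | unfold Re, fpole; simpl fst; lra |].
    apply holo_ccont, Hg; unfold fpole; simpl fst; simpl snd; lra.
Qed.

(** On each half of Gamma [mu] is constant. Closing the upper half, of weight [-1/2], and the lower
    half, of weight [1/2], along the real axis adds two copies of half the integral of [f] over
    [[1, 4 T^2 + 1]]; these are compensated by the first term. *)
Lemma Gamma_split :
  Gamma_integral T h x =
  (CInt (fun t => f_fun T (t, 0)%R x) 1 (4 * T ^ 2 + 1)
   - rect_int (fun u => f_fun T u x * m_fun h u) 1 (4 * T ^ 2 + 1) (- (2 * PI * flen T x)) (2 * PI * flen T x)
   - / 2 * rect_int (fun u => f_fun T u x) 1 (4 * T ^ 2 + 1) 0 (2 * PI * flen T x)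
   + / 2 * rect_int (fun u => f_fun T u x) 1 (4 * T ^ 2 + 1) (- (2 * PI * flen T x)) 0)%C.
Proof.
  pose proof flen_pi as Hb0. set (a := 2 * PI * flen T x). set (X := 4 * T ^ 2 + 1).
  assert (Ha : 0 < a) by (unfold a; lra).
  assert (HX : 1 <= X) by (unfold X; nra).
  assert (Eh1 : RtoC (-1/2) = (- / 2)%C) by
    (rewrite <- RtoC_inv by lra; unfold Copp, RtoC; simpl; f_equal; field).
  assert (Eh2 : RtoC (1/2) = (/ 2)%C) by
    (rewrite <- RtoC_inv by lra; unfold RtoC; simpl; f_equal; field).
  assert (Dpos : forall u : C, 0 <= snd u ->
     (f_fun T u x * delta h u = (- / 2) * f_fun T u x + (- (1)) * (f_fun T u x * m_fun h u))%C).
  { intros u Hu. unfold delta, mu, Im. destruct (Rle_dec 0 (snd u)); [|contradiction].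
    rewrite Eh1. ring. }
  assert (Dneg : forall u : C, snd u < 0 ->
     (f_fun T u x * delta h u = (/ 2) * f_fun T u x + (- (1)) * (f_fun T u x * m_fun h u))%C).
  { intros u Hu. unfold delta, mu, Im. destruct (Rle_dec 0 (snd u)); [lra|].
    rewrite Eh2. ring. }
  assert (Hfe : forall s t, s = 1 \/ s = -1 -> 1 <= t <= X -> holo (fun u => f_fun T u x) (t, s * a)).
  { intros s t Hs Ht. apply f_holo_region; simpl fst; simpl snd; try lra.
    - fold a. destruct Hs; subst s; apply Rabs_le; lra.
    - intros E. apply (f_equal snd) in E. unfold fpole, a in E; simpl in E. destruct Hs; subst s; nra.
    - intros E. apply (f_equal snd) in E. unfold fpole, a in E; simpl in E. destruct Hs; subst s; nra. }
  assert (Hme : forall s t, s = 1 \/ s = -1 -> holo (m_fun h) (t, s * a)).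
  { intros s t Hs. apply m_holo_off_axis; [lra|]. simpl. destruct Hs; subst s; lra. }
  assert (ICf : forall s, s = 1 \/ s = -1 -> ex_CInt (fun t => f_fun T (t, (s * a)%R) x) 1 X).
  { intros s Hs. apply (ex_CInt_h (fun u => f_fun T u x)); [lra|].
    intros t Ht. apply holo_ccont, Hfe; assumption. }
  assert (ICm : forall s, s = 1 \/ s = -1 ->
     ex_CInt (fun t => f_fun T (t, (s * a)%R) x * m_fun h (t, (s * a)%R))%C 1 X).
  { intros s Hs. apply (ex_CInt_h (fun u => f_fun T u x * m_fun h u)%C); [lra|].
    intros t Ht. apply holo_ccont, holo_mult; [apply Hfe | apply Hme]; assumption. }
  assert (HV : forall v, v = 1 \/ v = X ->
    CInt (fun s => f_fun T (v, s) x * delta h (v, s))%C (- a) a =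
    (/ 2 * CInt (fun s => f_fun T (v, s) x) (- a) 0 - / 2 * CInt (fun s => f_fun T (v, s) x) 0 a
     - CInt (fun s => f_fun T (v, s) x * m_fun h (v, s)) (- a) a)%C).
  { intros v Hv.
    assert (Hf : forall t, - a <= t <= a -> holo (fun u => f_fun T u x) (v, t)).
    { intros t Ht. destruct Hv; subst v; [apply f_holo_cut_1 | apply f_holo_cut_X]; fold a;
      apply Rabs_le; lra. }
    assert (Hm : forall t, holo (m_fun h) (v, t)).
    { intros t. destruct Hv; subst v.
      - replace 1 with (INR 0 * h + 1) by (simpl; ring). apply m_holo_cut.
      - unfold X. rewrite HT. apply m_holo_cut. }
    assert (If : forall p q, - a <= p <= q -> q <= a -> ex_CInt (fun s => f_fun T (v, s) x) p q).
    { intros p q H1 H2. apply (ex_CInt_v (fun u => f_fun T u x)); [lra|].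
      intros t Ht. apply holo_ccont, Hf. lra. }
    assert (Ifm : forall p q, - a <= p <= q -> q <= a ->
       ex_CInt (fun s => f_fun T (v, s) x * m_fun h (v, s))%C p q).
    { intros p q H1 H2. apply (ex_CInt_v (fun u => f_fun T u x * m_fun h u)%C); [lra|].
      intros t Ht. apply holo_ccont, holo_mult; [apply Hf; lra | apply Hm]. }
    rewrite <- (CInt_Chasles (fun s => f_fun T (v, s) x * m_fun h (v, s))%C (- a) 0 a);
      [|apply Ifm; lra..].
    apply is_CInt_unique.
    replace (/ 2 * CInt (fun s : R => f_fun T (v, s) x) (- a) 0 -
      / 2 * CInt (fun s : R => f_fun T (v, s) x) 0 a -
      (CInt (fun s : R => f_fun T (v, s) x * m_fun h (v, s)) (- a) 0 +
       CInt (fun s : R => f_fun T (v, s) x * m_fun h (v, s)) 0 a))%C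
    with ((/ 2 * CInt (fun s : R => f_fun T (v, s) x) (- a) 0
      + (- (1)) * CInt (fun s : R => f_fun T (v, s) x * m_fun h (v, s)) (- a) 0)
      + (- / 2 * CInt (fun s : R => f_fun T (v, s) x) 0 a
      + (- (1)) * CInt (fun s : R => f_fun T (v, s) x * m_fun h (v, s)) 0 a))%C by ring.
    (* The vertical sides are cut at the jump of [mu]; on each open half [delta] is a constant minus
       [m]. *)
    apply is_CInt_Chasles with 0.
    - apply (is_CInt_ext (fun s => / 2 * f_fun T (v, s) x + (- (1)) * (f_fun T (v, s) x * m_fun h (v, s)))%C).
      + intros t. rewrite Rmin_left, Rmax_right by lra. intros Ht. symmetry. apply Dneg. simpl; lra.
      + apply is_CInt_plus; apply is_CInt_mult, CInt_correct; [apply If | apply Ifm]; lra.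
    - apply (is_CInt_ext (fun s => - / 2 * f_fun T (v, s) x + (- (1)) * (f_fun T (v, s) x * m_fun h (v, s)))%C).
      + intros t. rewrite Rmin_left, Rmax_right by lra. intros Ht. symmetry. apply Dpos. simpl; lra.
      + apply is_CInt_plus; apply is_CInt_mult, CInt_correct; [apply If | apply Ifm]; lra. }
  assert (HB : CInt (fun t => f_fun T (t, (- a)%R) x * delta h (t, (- a)%R))%C 1 X =
    (/ 2 * CInt (fun t => f_fun T (t, (- a)%R) x) 1 X
     + (- (1)) * CInt (fun t => f_fun T (t, (- a)%R) x * m_fun h (t, (- a)%R)) 1 X)%C).
  { pose proof (ICf (-1) (or_intror eq_refl)) as J1. pose proof (ICm (-1) (or_intror eq_refl)) as J2.
    replace (-1 * a) with (- a) in J1, J2 by ring.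
    apply is_CInt_unique.
    apply (is_CInt_ext (fun t => / 2 * f_fun T (t, (- a)%R) x + (- (1)) * (f_fun T (t, (- a)%R) x * m_fun h (t, (- a)%R)))%C).
    - intros t _. symmetry. apply Dneg. simpl; lra.
    - apply is_CInt_plus; apply is_CInt_mult, CInt_correct; assumption. }
  assert (HTp : CInt (fun t => f_fun T (t, a) x * delta h (t, a))%C 1 X =
    (- / 2 * CInt (fun t => f_fun T (t, a) x) 1 X
     + (- (1)) * CInt (fun t => f_fun T (t, a) x * m_fun h (t, a)) 1 X)%C).
  { pose proof (ICf 1 (or_introl eq_refl)) as J1. pose proof (ICm 1 (or_introl eq_refl)) as J2.
    rewrite Rmult_1_l in J1, J2.
    apply is_CInt_unique.
    apply (is_CInt_ext (fun t => - / 2 * f_fun T (t, a) x + (- (1)) * (f_fun T (t, a) x * m_fun h (t, a)))%C).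
    - intros t _. symmetry. apply Dpos. simpl; lra.
    - apply is_CInt_plus; apply is_CInt_mult, CInt_correct; assumption. }
  change (Gamma_integral T h x) with (rect_int (fun u => f_fun T u x * delta h u)%C 1 X (- a) a).
  unfold rect_int. rewrite HB, HTp, (HV 1), (HV X) by tauto.
  field.
Qed.

(** Each pole of [f] is counted once with factor [- m], from an outer rectangle, and once with
    factor [mu], from a half rectangle. The two add up to [delta] at the pole, which is what makes
    the contribution small. *)
Theorem Gamma_eval :
  Gamma_integral T h x =
  (CInt (fun t => f_fun T (t, 0)%R x) 1 (4 * T ^ 2 + 1)
   - RtoC (sum_1_to n (fun j => h * freal T x (INR j * h))%R)
   + 2 * PI * Ci * fres 1 * (RtoC (-1/2) - m_fun h (fpole T x 1))
   + 2 * PI * Ci * fres (-1) * (RtoC (1/2) - m_fun h (fpole T x (-1))))%C.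
Proof.
  pose proof flen_pi as Hb0. pose proof fpole_re as Hre. pose proof PI_RGT_0.
  (* The level [b] is half the height of the poles of [f]. *)
  rewrite Gamma_split. set (a := 2 * PI * flen T x). set (b := PI * flen T x / 2).
  assert (Hab : 0 < b < a) by (unfold a, b; lra).
  assert (Hc1 : forall t, - a <= t <= a -> ccont (fun u => f_fun T u x * m_fun h u)%C (1, t)).
  { intros t Ht. apply holo_ccont, holo_mult.
    - apply f_holo_cut_1. fold a. apply Rabs_le. lra.
    - replace 1 with (INR 0 * h + 1) by (simpl; ring). apply m_holo_cut. }
  assert (HcX : forall t, - a <= t <= a -> ccont (fun u => f_fun T u x * m_fun h u)%C (4 * T ^ 2 + 1, t)).
  { intros t Ht. apply holo_ccont, holo_mult.
    - apply f_holo_cut_X. fold a. apply Rabs_le. lra.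
    - rewrite HT. apply m_holo_cut. }
  rewrite (rect_int_split_y _ 1 (4 * T ^ 2 + 1) (- a) (- b) a); [|lra|lra|exact Hc1|exact HcX].
  rewrite (rect_int_split_y _ 1 (4 * T ^ 2 + 1) (- b) b a);
    [|lra|lra|intros; apply Hc1; lra|intros; apply HcX; lra].
  pose proof (rect_int_strip n) as Hstrip. fold b in Hstrip. rewrite <- HT in Hstrip. rewrite Hstrip.
  assert (Hone : forall s y0 y1, s = 1 \/ s = -1 ->
    - a <= y0 -> y0 < s * (PI * flen T x) < y1 -> y1 <= a ->
    (forall t, y0 <= t <= y1 -> t <> - s * (PI * flen T x)) ->
    rect_int (fun u => f_fun T u x) 1 (4 * T ^ 2 + 1) y0 y1 = (2 * PI * Ci * fres s)%C).
  { intros s y0 y1 Hs H1 H2 H3 H4.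
    transitivity (rect_int (fun u => f_fun T u x * 1)%C 1 (4 * T ^ 2 + 1) y0 y1).
    - apply rect_int_ext. intros u. ring.
    - rewrite (rect_int_half_pole (fun _ => RtoC 1) s y0 y1); try assumption; [ring|].
      intros. apply holo_const. }
  rewrite (rect_int_half_pole (m_fun h) 1 b a), (rect_int_half_pole (m_fun h) (-1) (- a) (- b)),
    (Hone 1 0 a), (Hone (-1) (- a) 0);
    try tauto; try (unfold a, b; lra); try (intros; apply m_holo_off_axis; lra);
    try (intros; unfold a, b in *; apply Rlt_not_eq; lra); try (intros; unfold a, b in *; apply Rgt_not_eq; lra).
  replace (RtoC (-1/2)) with (- / 2)%C by
    (rewrite <- RtoC_inv by lra; unfold Copp, RtoC; simpl; f_equal; field).
  replace (RtoC (1/2)) with (/ 2)%C by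
    (rewrite <- RtoC_inv by lra; unfold RtoC; simpl; f_equal; field).
  ring.
Qed.

End Contour.

(** * The real integral, sums and polynomials *)

Lemma atan_le_id (y : R) : 0 <= y -> atan y <= y.
Proof.
  intros [Hy|<-]; [|rewrite atan_0; lra].
  destruct (MVT_cor2 atan (fun t => / (1 + t ^ 2)) 0 y Hy) as [c [E Hc]].
  { intros c _. apply derivable_pt_lim_atan. }
  rewrite atan_0 in E.
  assert (H : / (1 + c ^ 2) <= 1).
  { rewrite <- Rinv_1. apply Rinv_le_contravar; [lra|]. pose proof (pow2_ge_0 c). lra. }
  assert (0 <= / (1 + c ^ 2)) by (apply Rlt_le, Rinv_0_lt_compat; pose proof (pow2_ge_0 c); lra).
  nra.
Qed.

(** The arctangent primitive of [(2 x / PI) / (s^2 + x)] at [s = exp (sqrt u - T)]; its total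
    variation over [0 < s] is [sqrt x]. *)
Definition fprim (T x u : R) : R := 2 * sqrt x / PI * atan (exp (sqrt u - T) / sqrt x).

Lemma is_derive_fprim (T x u : R) : 0 < x -> 0 < u -> is_derive (fprim T x) u (freal T x u).
Proof.
  intros Hx Hu. unfold fprim, freal. pose proof (sqrt_lt_R0 x Hx) as Hs. pose proof (sqrt_lt_R0 u Hu) as Hsu.
  pose proof PI_RGT_0.
  auto_derive; [exact Hu|].
  replace (exp (2 * (sqrt u - T))) with (exp (sqrt u - T) * exp (sqrt u - T))
    by (rewrite <- exp_plus; f_equal; ring).
  replace (sqrt u + - T) with (sqrt u - T) by ring.
  pose proof (exp_pos (sqrt u - T)) as He. set (E := exp (sqrt u - T)) in *.
  assert (Er : x = sqrt x * sqrt x) by (symmetry; apply sqrt_sqrt; lra).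
  set (r := sqrt x) in *. clearbody r. subst x.
  unfold Rsqr. field. repeat split; try lra; apply Rgt_not_eq; nra.
Qed.

Lemma CInt_f_real (T x X : R) : 0 < x -> 1 <= X ->
  CInt (fun t => f_fun T (t, 0) x) 1 X = RtoC (fprim T x X - fprim T x 1).
Proof.
  intros Hx HX. apply is_CInt_unique.
  apply (is_CInt_ext (fun t => RtoC (freal T x t))).
  { intros t. rewrite Rmin_left, Rmax_right by lra. intros Ht. symmetry. apply f_fun_real; lra. }
  apply is_CInt_pair; simpl.
  - apply (is_RInt_derive (V := R_CompleteNormedModule) (fprim T x) (freal T x)).
    + intros t. rewrite Rmin_left, Rmax_right by lra. intros Ht. apply is_derive_fprim; lra.
    + intros t. rewrite Rmin_left, Rmax_right by lra. intros Ht.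
      apply (ex_derive_continuous (K := R_AbsRing) (V := R_NormedModule)).
      unfold freal. auto_derive.
      pose proof (sqrt_lt_R0 t ltac:(lra)). pose proof (exp_pos (2 * (sqrt t + - T))).
      repeat split; lra.
  - pose proof (is_RInt_const (V := R_NormedModule) 1 X 0) as H.
    change (scal (X - 1) 0) with ((X - 1) * 0) in H. rewrite Rmult_0_r in H. exact H.
Qed.

(** With [r = sqrt x], the part beyond [s >= exp T] misses at most [r / s] of arctangent, the part
    below [s1 = exp (1 - T)] at most [s1 / r]. After multiplication by [r] they are at most
    [exp (- T)] and [3 * exp (- T)], and [(2 / PI) * 4 <= 3]. *)
Lemma integral_error (T x : R) : 0 < x <= 1 -> 0 <= T ->
  Rabs (fprim T x (4 * T ^ 2 + 1) - fprim T x 1 - sqrt x) <= 3 * exp (- T).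
Proof.
  intros Hx HT. pose proof PI_RGT_0 as HP0. pose proof PI2_3_2 as HP.
  pose proof (sqrt_lt_R0 x ltac:(lra)) as Hs. pose proof (exp_pos (- T)) as He.
  assert (Hs1 : sqrt x <= 1) by (rewrite <- sqrt_1; apply sqrt_le_1_alt; lra).
  set (r := sqrt x) in *. unfold fprim. fold r.
  set (s := exp (sqrt (4 * T ^ 2 + 1) - T)).
  assert (Hsb : exp T <= s).
  { unfold s.
    assert (H2 : 2 * T <= sqrt (4 * T ^ 2 + 1)).
    { rewrite <- (sqrt_square (2 * T)) by lra. apply sqrt_le_1_alt. nra. }
    destruct (Req_dec T (sqrt (4 * T ^ 2 + 1) - T)) as [E|E]; [rewrite <- E; lra|].
    left. apply exp_increasing. lra. }
  assert (Hs0 : 0 < s) by apply exp_pos.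
  assert (HA : PI / 2 - atan (s / r) <= r * exp (- T)).
  { rewrite <- atan_inv by (apply Rdiv_lt_0_compat; assumption).
    eapply Rle_trans; [apply atan_le_id, Rlt_le, Rinv_0_lt_compat, Rdiv_lt_0_compat; assumption|].
    replace (/ (s / r)) with (r * / s) by (field; lra).
    apply Rmult_le_compat_l; [lra|]. rewrite exp_Ropp. apply Rinv_le_contravar; [apply exp_pos | exact Hsb]. }
  pose proof (atan_bound (s / r)) as [_ HA0].
  assert (E1 : exp (sqrt 1 - T) <= 3 * exp (- T)).
  { rewrite sqrt_1. replace (1 - T) with (1 + - T) by ring. rewrite exp_plus. pose proof exp_le_3. nra. }
  pose proof (exp_pos (sqrt 1 - T)) as E0.
  set (s1 := exp (sqrt 1 - T)) in *.
  assert (HB : 0 <= atan (s1 / r) <= 3 * exp (- T) / r).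
  { assert (0 < s1 / r) by (apply Rdiv_lt_0_compat; assumption).
    split; [rewrite <- atan_0; left; apply atan_increasing; assumption|].
    eapply Rle_trans; [apply atan_le_id; lra|]. apply Rmult_le_compat_r; [|exact E1].
    apply Rlt_le, Rinv_0_lt_compat, Hs. }
  set (A := atan (s / r)) in *. set (B := atan (s1 / r)) in *.
  replace (2 * r / PI * A - 2 * r / PI * B - r) with (- (2 / PI) * (r * (PI / 2 - A) + r * B)) by (field; lra).
  rewrite Rabs_mult, Rabs_Ropp.
  assert (HrB : r * B <= 3 * exp (- T)).
  { apply Rle_trans with (r * (3 * exp (- T) / r)); [apply Rmult_le_compat_l; lra|]. right. field. lra. }
  assert (HrA : r * (PI / 2 - A) <= exp (- T)) by nra.
  rewrite (Rabs_pos_eq (2 / PI)) by (apply Rlt_le, Rdiv_lt_0_compat; lra).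
  rewrite Rabs_pos_eq by nra.
  apply Rle_trans with (2 / PI * (4 * exp (- T))).
  - apply Rmult_le_compat_l; [apply Rlt_le, Rdiv_lt_0_compat; lra | lra].
  - replace (2 / PI * (4 * exp (- T))) with (8 * exp (- T) / PI) by (field; lra).
    apply Rmult_le_reg_r with PI; [lra|]. unfold Rdiv. rewrite Rmult_assoc, Rinv_l by lra. nra.
Qed.

Lemma sum_1_to_le (n : nat) (f g : nat -> R) :
  (forall j, (1 <= j <= n)%nat -> f j <= g j) -> sum_1_to n f <= sum_1_to n g.
Proof.
  induction n as [|n IH]; intros H; simpl; [lra|].
  apply Rplus_le_compat; [apply IH; intros; apply H; lia | apply H; lia].
Qed.

Lemma sum_1_to_ext (n : nat) (f g : nat -> R) :
  (forall j, (1 <= j <= n)%nat -> f j = g j) -> sum_1_to n f = sum_1_to n g.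
Proof.
  induction n as [|n IH]; intros H; simpl; [reflexivity|].
  rewrite IH by (intros; apply H; lia). rewrite H by lia. reflexivity.
Qed.

Lemma sum_1_to_scal (n : nat) (k : R) (f : nat -> R) :
  sum_1_to n (fun j => k * f j) = k * sum_1_to n f.
Proof. induction n as [|n IH]; simpl; [ring | rewrite IH; ring]. Qed.

Lemma sum_1_to_plus (n : nat) (f g : nat -> R) :
  sum_1_to n (fun j => f j + g j) = sum_1_to n f + sum_1_to n g.
Proof. induction n as [|n IH]; simpl; [ring | rewrite IH; ring]. Qed.

Lemma sum_1_to_abs (n : nat) (f : nat -> R) :
  Rabs (sum_1_to n f) <= sum_1_to n (fun j => Rabs (f j)).
Proof.
  induction n as [|n IH]; simpl; [rewrite Rabs_R0; lra|].
  eapply Rle_trans; [apply Rabs_triang|]. lra.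
Qed.

Lemma sum_1_to_truncate (n m : nat) (f : nat -> R) : (n <= m)%nat ->
  sum_1_to m (fun j => if le_dec j n then f j else 0) = sum_1_to n f.
Proof.
  induction 1 as [|m H IH].
  - apply sum_1_to_ext. intros j Hj. destruct (le_dec j n); [reflexivity | lia].
  - simpl. rewrite IH. destruct (le_dec (S m) n); [lia | ring].
Qed.

(* Comparison with the integral of exp (- sqrt u) / sqrt u, whose primitive is
   - 2 exp (- sqrt u). *)
Lemma sum_exp_sqrt_le (h : R) (n : nat) : 0 < h ->
  sum_1_to n (fun j => h * exp (- sqrt (INR j * h)) / sqrt (INR j * h)) <= 2.
Proof.
  intros Hh.
  assert (H : sum_1_to n (fun j => h * exp (- sqrt (INR j * h)) / sqrt (INR j * h))
     <= 2 * (1 - exp (- sqrt (INR n * h)))).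
  { induction n as [|n IH].
    - simpl. rewrite Rmult_0_l, sqrt_0, Ropp_0, exp_0. lra.
    - cbn [sum_1_to].
      set (p := sqrt (INR n * h)) in *. set (q := sqrt (INR (S n) * h)).
      assert (Hn : 0 <= INR n) by apply pos_INR.
      assert (Hp2 : p * p = INR n * h) by (apply sqrt_sqrt; nra).
      assert (Hq2 : q * q = INR n * h + h) by (unfold q; rewrite sqrt_sqrt, S_INR; rewrite ?S_INR; nra).
      assert (Hp : 0 <= p) by apply sqrt_pos.
      assert (Hq : 0 < q) by (apply sqrt_lt_R0; rewrite S_INR; nra).
      assert (Hpq : p <= q) by (apply sqrt_le_1_alt; rewrite S_INR; nra).
      assert (Hstep : h * exp (- q) / q <= 2 * (q - p) * exp (- q)).
      { apply Rmult_le_reg_r with q; [exact Hq|].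
        unfold Rdiv. rewrite Rmult_assoc, Rinv_l, Rmult_1_r by lra.
        (* As [h = q ^ 2 - p ^ 2], this is [(q - p) ^ 2 >= 0]. *)
        assert (Hh2 : h <= 2 * (q - p) * q) by (pose proof (Rle_0_sqr (q - p)); unfold Rsqr in *; lra).
        pose proof (exp_pos (- q)). nra. }
      assert (Hexp : (q - p) * exp (- q) <= exp (- p) - exp (- q)).
      { replace (exp (- p)) with (exp (q - p) * exp (- q)) by (rewrite <- exp_plus; f_equal; ring).
        pose proof (exp_ineq1_le (q - p)). pose proof (exp_pos (- q)). nra. }
      lra. }
  pose proof (exp_pos (- sqrt (INR n * h))). lra.
Qed.

(** A sigma type in [Set], so that coefficients can be projected out as data; [n] only bounds the
    degree. *)
Definition is_poly (n : nat) (P : R -> R) : Set :=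
  {c : nat -> R | forall x, P x = sum_f_R0 (fun k => c k * x ^ k) n}.

Lemma is_poly_const (n : nat) (k : R) : is_poly n (fun _ => k).
Proof.
  exists (fun i => match i with O => k | _ => 0 end). intros x.
  induction n as [|n IH]; simpl; [ring|]. rewrite <- IH. ring.
Qed.

Lemma is_poly_plus (n : nat) (P Q : R -> R) :
  is_poly n P -> is_poly n Q -> is_poly n (fun x => P x + Q x).
Proof.
  intros [c Hc] [d Hd]. exists (fun k => c k + d k). intros x. rewrite Hc, Hd, <- sum_plus.
  apply sum_eq. intros. ring.
Qed.

Lemma is_poly_scal (n : nat) (k : R) (P : R -> R) : is_poly n P -> is_poly n (fun x => k * P x).
Proof.
  intros [c Hc]. exists (fun i => k * c i). intros x. rewrite Hc, scal_sum.
  apply sum_eq. intros. ring.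
Qed.

Lemma is_poly_mult_X (n : nat) (P : R -> R) : is_poly n P -> is_poly (S n) (fun x => x * P x).
Proof.
  intros [c Hc]. exists (fun i => match i with O => 0 | S i => c i end). intros x.
  rewrite Hc, (decomp_sum _ (S n)) by lia. simpl pred. rewrite Rmult_0_l, Rplus_0_l, scal_sum.
  apply sum_eq. intros. simpl. ring.
Qed.

Lemma is_poly_S (n : nat) (P : R -> R) : is_poly n P -> is_poly (S n) P.
Proof.
  intros [c Hc]. exists (fun i => if le_dec i n then c i else 0). intros x.
  rewrite Hc. simpl. destruct (le_dec (S n) n); [lia|]. rewrite Rmult_0_l, Rplus_0_r.
  apply sum_eq. intros i Hi. destruct (le_dec i n); [reflexivity | lia].
Qed.

Lemma is_poly_ext (n : nat) (P Q : R -> R) : (forall x, P x = Q x) -> is_poly n P -> is_poly n Q.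
Proof. intros E [c Hc]. exists c. intros x. rewrite <- E. apply Hc. Qed.

Lemma is_poly_sum (n m : nat) (P : nat -> R -> R) :
  (forall j, is_poly n (P j)) -> is_poly n (fun x => sum_1_to m (fun j => P j x)).
Proof.
  intros H. induction m as [|m IH]; simpl; [apply is_poly_const | apply is_poly_plus; [exact IH | apply H]].
Qed.

(* Taylor polynomials of 1 / (x + q) at x = 1/2. *)
Fixpoint recip_taylor (q : R) (n : nat) (x : R) : R :=
  match n with
  | O => 0
  | S n => / (q + / 2) + (/ 2 - x) / (q + / 2) * recip_taylor q n x
  end.

Lemma recip_taylor_poly (q : R) (n : nat) : is_poly n (recip_taylor q n).
Proof.
  induction n as [|n IH]; [apply is_poly_const|]. simpl.
  apply is_poly_plus; [apply is_poly_const|].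
  apply (is_poly_ext _ (fun x => / (q + / 2) * (/ 2 * recip_taylor q n x + (- (1)) * (x * recip_taylor q n x)))).
  { intros x. unfold Rdiv. ring. }
  apply is_poly_scal, is_poly_plus; [apply is_poly_scal, is_poly_S, IH|].
  apply is_poly_scal, is_poly_mult_X, IH.
Qed.

(** Each step of the recursion multiplies the error by [(1/2 - x) / (q + 1/2)], of modulus at most
    [(1/2) / (3/2)]. The bound is relative to [/ (x + q)], so that summing over nodes gives back a
    multiple of [trap]. *)
Lemma recip_taylor_error (q x : R) (n : nat) : 1 <= q -> 0 <= x <= 1 ->
  Rabs (recip_taylor q n x - / (x + q)) <= (/ 3) ^ n * / (x + q).
Proof.
  intros Hq Hx. assert (Hp : 0 < / (x + q)) by (apply Rinv_0_lt_compat; lra).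
  induction n as [|n IH]; simpl.
  - rewrite Rminus_0_l, Rabs_Ropp, Rabs_pos_eq; lra.
  - replace (/ (q + / 2) + (/ 2 - x) / (q + / 2) * recip_taylor q n x - / (x + q))
      with ((/ 2 - x) / (q + / 2) * (recip_taylor q n x - / (x + q))) by (field; lra).
    rewrite Rabs_mult, Rmult_assoc. apply Rmult_le_compat; try apply Rabs_pos; [|exact IH].
    unfold Rdiv. rewrite Rabs_mult, (Rabs_pos_eq (/ _)) by (apply Rlt_le, Rinv_0_lt_compat; lra).
    apply Rmult_le_reg_r with (q + / 2); [lra|]. rewrite Rmult_assoc, Rinv_l by lra.
    assert (Rabs (/ 2 - x) <= / 2) by (apply Rabs_le; lra). lra.
Qed.

(** * The rational approximation *)

(** The [j]-th term of the trapezoidal sum is [amp * x / (x + offset)]: [- offset] is its pole in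
    [x] and [amp] its limit at infinity. *)
Definition amp (T h : R) (j : nat) : R :=
  h * exp (sqrt (INR j * h) - T) / (PI * sqrt (INR j * h)).

Definition offset (T h : R) (j : nat) : R := exp (2 * (sqrt (INR j * h) - T)).

Definition trap (T h : R) (n : nat) (x : R) : R :=
  sum_1_to n (fun j => h * freal T x (INR j * h)).

Lemma sqrt_node_pos (h : R) (j : nat) : 0 < h -> (1 <= j)%nat -> 0 < sqrt (INR j * h).
Proof. intros Hh Hj. apply sqrt_lt_R0. apply le_INR in Hj. simpl in Hj. nra. Qed.

Lemma trap_term (T h x : R) (j : nat) : 0 < h -> (1 <= j)%nat -> 0 <= x ->
  h * freal T x (INR j * h) = amp T h j * (x * / (x + offset T h j)).
Proof.
  intros Hh Hj Hx. pose proof (sqrt_node_pos h j Hh Hj). pose proof PI_RGT_0.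
  pose proof (exp_pos (2 * (sqrt (INR j * h) - T))).
  unfold freal, amp, offset. field. repeat split; lra.
Qed.

(** From [E / (x + E ^ 2) <= 1 / E] and [/ PI <= / 2]. The bound is linear in [x] with a summable
    factor, as the range of small [x] requires. *)
Lemma trap_term_bound (T h x : R) (j : nat) : 0 < h -> (1 <= j)%nat -> 0 <= x ->
  0 <= h * freal T x (INR j * h) <=
    x * exp T / 2 * (h * exp (- sqrt (INR j * h)) / sqrt (INR j * h)).
Proof.
  intros Hh Hj Hx. rewrite trap_term by assumption. unfold amp, offset.
  pose proof (sqrt_node_pos h j Hh Hj) as Hs. pose proof PI_RGT_0 as HP. pose proof PI2_3_2 as HP3.
  set (s := sqrt (INR j * h)) in *.
  set (E := exp (s - T)). assert (HE : 0 < E) by apply exp_pos.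
  replace (exp (2 * (s - T))) with (E * E) by (unfold E; rewrite <- exp_plus; f_equal; ring).
  assert (HEE : 0 < E * E) by nra.
  assert (Ei : exp T * exp (- s) = / E).
  { unfold E. rewrite <- exp_Ropp, <- exp_plus. f_equal. ring. }
  split.
  - apply Rmult_le_pos; [apply Rlt_le, Rdiv_lt_0_compat; nra|].
    apply Rmult_le_pos; [exact Hx | apply Rlt_le, Rinv_0_lt_compat; lra].
  - replace (x * exp T / 2 * (h * exp (- s) / s)) with (x * h / s * (exp T * exp (- s)) / 2) by (field; lra).
    rewrite Ei.
    replace (h * E / (PI * s) * (x * / (x + E * E))) with (x * h / s * (E * / (x + E * E)) * / PI)
      by (field; repeat split; lra).
    assert (H0 : 0 <= x * h / s) by (apply Rmult_le_pos; [nra | apply Rlt_le, Rinv_0_lt_compat, Hs]).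
    apply Rmult_le_compat; [| apply Rlt_le, Rinv_0_lt_compat, HP | | apply Rinv_le_contravar; lra].
    + apply Rmult_le_pos; [exact H0|]. apply Rmult_le_pos; [lra | apply Rlt_le, Rinv_0_lt_compat; lra].
    + apply Rmult_le_compat_l; [exact H0|].
      apply Rle_trans with (E * / (E * E)).
      * apply Rmult_le_compat_l; [lra|]. apply Rinv_le_contravar; lra.
      * right. field. lra.
Qed.

Lemma sum_1_to_0 (n : nat) : sum_1_to n (fun _ => 0) = 0.
Proof. induction n as [|n IH]; simpl; [reflexivity | rewrite IH; ring]. Qed.

Lemma trap_bound (T h x : R) (n : nat) : 0 < h -> 0 <= x -> 0 <= trap T h n x <= x * exp T.
Proof.
  intros Hh Hx. unfold trap. split.
  - rewrite <- (sum_1_to_0 n). apply sum_1_to_le. intros j Hj. apply trap_term_bound; [lra | lia | lra].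
  - eapply Rle_trans; [apply sum_1_to_le; intros j Hj; apply trap_term_bound; [lra | lia | lra]|].
    rewrite sum_1_to_scal. pose proof (sum_exp_sqrt_le h n Hh) as H.
    pose proof (exp_pos T).
    apply Rle_trans with (x * exp T / 2 * 2); [|lra]. apply Rmult_le_compat_l; [nra | exact H].
Qed.

Lemma exp_le_mono (a b : R) : a <= b -> exp a <= exp b.
Proof. intros [H|H]; [left; apply exp_increasing, H | rewrite H; lra]. Qed.

(** For large [x], 23 is 12 from the contour, 4 from each of the two poles and 3 from the truncated
    integral. For small [x], [sqrt x] contributes at most [exp 2] and the sum at most [exp 4]; this
    case includes [x = 0]. *)
Lemma trap_error (T x : R) (n : nat) :
  let h := 2 * PI ^ 2 in
  0 <= T -> 4 * T ^ 2 = INR n * h -> 0 <= x <= 1 ->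
  (exp (4 - 2 * T) <= x -> Cmod (Gamma_integral T h x) < 12 * exp (- T)) ->
  Rabs (trap T h n x - sqrt x) <= (exp 4 + exp 2 + 23) * exp (- T).
Proof.
  intros h HT0 HT Hx HG. pose proof PI_RGT_0 as HP0. pose proof PI2_3_2 as HP.
  assert (Hh : 1 < h) by (unfold h; nra).
  pose proof (exp_pos (- T)) as He. pose proof (exp_pos 4) as He4. pose proof (exp_pos 2) as He2.
  destruct (Rle_dec (exp (4 - 2 * T)) x) as [Hbig|Hsmall].
  - assert (Hx0 : 0 < x) by (eapply Rlt_le_trans; [apply exp_pos | exact Hbig]).
    specialize (HG Hbig).
    assert (HL : 2 <= flen T x).
    { unfold flen. assert (H : 4 - 2 * T <= ln x); [|lra].
      rewrite <- (ln_exp (4 - 2 * T)). destruct Hbig as [Hb|Hb]; [|rewrite Hb; lra].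
      left. apply ln_increasing; [apply exp_pos | exact Hb]. }
    pose proof (Gamma_eval T x h n ltac:(lra) HL Hh HT) as EG.
    rewrite CInt_f_real in EG by nra. fold (trap T h n x) in EG.
    pose proof (integral_error T x ltac:(lra) HT0) as HI.
    set (I := fprim T x (4 * T ^ 2 + 1) - fprim T x 1) in *.
    destruct (delta_fpole T x ltac:(lra)) as [HD1 HD2]. fold h in HD1, HD2.
    set (D1 := (RtoC (-1/2) - m_fun h (fpole T x 1))%C) in *.
    set (D2 := (RtoC (1/2) - m_fun h (fpole T x (-1)))%C) in *.
    pose proof (sqrt_lt_R0 x Hx0) as Hs.
    assert (Hres : forall s, s = 1 \/ s = -1 -> Cmod (2 * PI * Ci * fres x s)%C = 2 * sqrt x).
    { intros s Hs1. rewrite !Cmod_mult, Cmod_Ci, !Cmod_R, !Rabs_pos_eq by lra.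
      unfold fres. rewrite Cmod_im, Rabs_Ropp.
      replace (Rabs (s * sqrt x / PI)) with (sqrt x / PI); [field; lra|].
      destruct Hs1; subst s.
      - rewrite Rmult_1_l, Rabs_pos_eq; [reflexivity | apply Rlt_le, Rdiv_lt_0_compat; lra].
      - replace (-1 * sqrt x / PI) with (- (sqrt x / PI)) by (field; lra).
        rewrite Rabs_Ropp, Rabs_pos_eq; [reflexivity | apply Rlt_le, Rdiv_lt_0_compat; lra]. }
    (* Here the size of the residue and the decay of [delta] at the pole compensate exactly. *)
    assert (HLT : sqrt x * exp (- flen T x) = exp (- T)).
    { rewrite <- (exp_flen T x Hx0), <- exp_plus. f_equal. ring. }
    assert (HIS : Rabs (I - trap T h n x) <= 20 * exp (- T)).
    { rewrite <- Cmod_R.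
      replace (RtoC (I - trap T h n x)) with
        (Gamma_integral T h x - (2 * PI * Ci * fres x 1) * D1 - (2 * PI * Ci * fres x (-1)) * D2)%C
        by (rewrite EG, RtoC_minus; ring).
      unfold Cminus. eapply Rle_trans; [apply Cmod_triangle|]. rewrite Cmod_opp.
      eapply Rle_trans; [apply Rplus_le_compat_r, Cmod_triangle|]. rewrite Cmod_opp.
      rewrite (Cmod_mult _ D1), (Cmod_mult _ D2), !Hres by tauto.
      set (E := exp (- flen T x)) in *.
      assert (2 * sqrt x * Cmod D1 <= 4 * exp (- T)) by nra.
      assert (2 * sqrt x * Cmod D2 <= 4 * exp (- T)) by nra.
      lra. }
    apply Rabs_le. apply Rabs_le_between in HIS. apply Rabs_le_between in HI. nra.
  - apply Rnot_le_lt in Hsmall.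
    assert (HE : exp (4 - 2 * T) = exp 4 * (exp (- T) * exp (- T))).
    { rewrite <- !exp_plus. f_equal. ring. }
    assert (Hsq : sqrt x <= exp 2 * exp (- T)).
    { rewrite <- (sqrt_square (exp 2 * exp (- T))) by nra. apply sqrt_le_1_alt.
      replace (exp 2 * exp (- T) * (exp 2 * exp (- T))) with (exp (4 - 2 * T)); [lra|].
      rewrite <- !exp_plus. f_equal. ring. }
    pose proof (sqrt_pos x). destruct (trap_bound T h x n ltac:(lra) ltac:(lra)) as [Ht0 Ht1].
    assert (HT1 : x * exp T <= exp 4 * exp (- T)).
    { apply Rle_trans with (exp (4 - 2 * T) * exp T).
      - apply Rmult_le_compat_r; [apply Rlt_le, exp_pos | lra].
      - right. rewrite <- !exp_plus. f_equal. ring. }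
    apply Rabs_le. nra.
Qed.

(** For [j <= N1], [amp * x / (x + q) = amp - amp * q / (x + q)]: the fraction is the prescribed
    pole term, with coefficient [amp * pole], and only the constant is left to the polynomial. *)
Definition poly_term (T h : R) (N1 k j : nat) (x : R) : R :=
  if le_dec j N1 then amp T h j else amp T h j * (x * recip_taylor (offset T h j) k x).

Lemma poly_term_poly (T h : R) (N1 k j : nat) : is_poly (S k) (poly_term T h N1 k j).
Proof.
  unfold poly_term. destruct (le_dec j N1); [apply is_poly_const|].
  apply is_poly_scal, is_poly_mult_X, recip_taylor_poly.
Qed.

Definition poly_coef (T h : R) (N1 k n : nat) : nat -> R :=
  proj1_sig (is_poly_sum (S k) n _ (poly_term_poly T h N1 k)).

(** Terms with [j <= N1] agree exactly and the others have relative error [(/ 3) ^ k], so the total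
    is at most that fraction of [trap], itself at most [exp T] on [[0, 1]]. *)
Lemma r_fun_error (T h x : R) (N1 k n : nat) : 0 < h -> 0 <= x <= 1 -> (N1 <= n)%nat ->
  (forall j, pole N1 j = - offset T h j) ->
  (forall j, (N1 < j)%nat -> 1 <= offset T h j) ->
  Rabs (r_fun N1 (S k) (fun j => amp T h j * pole N1 j) (poly_coef T h N1 k n) x - trap T h n x)
  <= (/ 3) ^ k * exp T.
Proof.
  intros Hh Hx Hn Hpole Hoff. unfold r_fun, poly_coef.
  rewrite <- (proj2_sig (is_poly_sum (S k) n _ (poly_term_poly T h N1 k))).
  (* The pole sum is padded with zeros up to [n], so that all sums are compared index by index. *)
  rewrite <- (sum_1_to_truncate N1 n) by exact Hn.
  assert (H3 : 0 < (/ 3) ^ k) by (apply pow_lt; lra).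
  rewrite <- sum_1_to_plus. unfold trap.
  replace (sum_1_to n (fun j => h * freal T x (INR j * h)))
    with (- sum_1_to n (fun j => - (1) * (h * freal T x (INR j * h)))) by (rewrite sum_1_to_scal; ring).
  unfold Rminus. rewrite Ropp_involutive, <- sum_1_to_plus.
  eapply Rle_trans; [apply sum_1_to_abs|].
  apply Rle_trans with (sum_1_to n (fun j => (/ 3) ^ k * (h * freal T x (INR j * h)))).
  - apply sum_1_to_le. intros j Hj.
    pose proof (trap_term_bound T h x j Hh ltac:(lia) ltac:(lra)) as [Hpos _].
    rewrite trap_term in * by (lra || lia). unfold poly_term. rewrite Hpole.
    assert (Hq : 0 < offset T h j) by apply exp_pos.
    assert (Ha : 0 < amp T h j).
    { unfold amp. pose proof (sqrt_node_pos h j Hh ltac:(lia)). pose proof PI_RGT_0.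
      pose proof (exp_pos (sqrt (INR j * h) - T)). apply Rdiv_lt_0_compat; nra. }
    destruct (le_dec j N1) as [Hj1|Hj1].
    + match goal with |- Rabs ?e <= _ => replace e with 0 by (field; lra) end.
      rewrite Rabs_R0. nra.
    + replace (0 + amp T h j * (x * recip_taylor (offset T h j) k x) +
        - (1) * (amp T h j * (x * / (x + offset T h j))))
      with (amp T h j * x * (recip_taylor (offset T h j) k x - / (x + offset T h j))) by ring.
      rewrite Rabs_mult, (Rabs_pos_eq (amp T h j * x)) by nra.
      replace ((/ 3) ^ k * (amp T h j * (x * / (x + offset T h j))))
        with (amp T h j * x * ((/ 3) ^ k * / (x + offset T h j))) by ring.
      apply Rmult_le_compat_l; [nra|]. apply recip_taylor_error; [apply Hoff; lia | lra].
  - rewrite sum_1_to_scal. apply Rmult_le_compat_l; [lra|].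
    pose proof (trap_bound T h x n Hh ltac:(lra)) as [_ H]. unfold trap in H.
    pose proof (exp_pos T). nra.
Qed.

Lemma sqrt_2_bounds : 14 / 10 <= sqrt 2 <= 1415 / 1000.
Proof.
  pose proof (sqrt_sqrt 2 ltac:(lra)) as H. pose proof (sqrt_pos 2). split; nra.
Qed.

(** [(/ 3) ^ k * exp T <= exp (- T)] holds once [2 * T <= k], and [2 * T = 2 * PI * sqrt 2 * sqrt N1
    <= 10 * sqrt N1]. *)
Definition taylor_deg (N1 : nat) : nat := Z.to_nat (up (10 * sqrt (INR N1))).

Lemma taylor_deg_bounds (N1 : nat) :
  10 * sqrt (INR N1) <= INR (taylor_deg N1) <= 10 * sqrt (INR N1) + 1.
Proof.
  unfold taylor_deg. pose proof (sqrt_pos (INR N1)).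
  destruct (archimed (10 * sqrt (INR N1))) as [H1 H2].
  assert (Hz : (0 <= up (10 * sqrt (INR N1)))%Z) by (apply le_IZR; lra).
  rewrite (INR_IZR_INZ (Z.to_nat _)), Z2Nat.id by exact Hz. lra.
Qed.

Lemma third_pow_le (k : nat) : (/ 3) ^ k <= exp (- INR k).
Proof.
  induction k as [|k IH].
  - simpl. rewrite Ropp_0, exp_0. lra.
  - rewrite S_INR. replace (- (INR k + 1)) with (- (1) + - INR k) by ring.
    rewrite exp_plus. simpl. apply Rmult_le_compat; [lra | apply pow_le; lra | | exact IH].
    rewrite exp_Ropp. apply Rinv_le_contravar; [apply exp_pos | apply exp_le_3].
Qed.

Theorem theorem2p3 :
  (exists M : nat, forall Nt : nat, (M <= Nt)%nat -> (1 <= Nt)%nat ->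
     let h := 2 * PI ^ 2 in
     let T := sqrt (INR Nt * h / 4) in
     forall x : R, exp (4 - 2 * T) <= x <= 1 ->
       Cmod (Gamma_integral T h x) < 12 * exp (- T)) ->
  exists (N2 : nat -> nat) (a c : nat -> nat -> R),
    (exists (K : R) (M : nat), forall N1 : nat, (M <= N1)%nat ->
        INR (N2 N1) <= K * sqrt (INR N1)) /\
    (exists (K : R) (M : nat), forall N1 : nat, (M <= N1)%nat ->
        forall x : R, 0 <= x <= 1 ->
          Rabs (r_fun N1 (N2 N1) (a N1) (c N1) x - sqrt x)
            <= K * exp (- PI * sqrt (2 * INR (N1 + N2 N1)))).
Proof.
  intros [M HM]. pose proof PI_RGT_0 as HP0. pose proof PI2_3_2 as HP.
  set (h := 2 * PI ^ 2). assert (Hh : 0 < h) by (unfold h; nra).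
  (* The value of [sqrt (Nt * h / 4)] at [Nt = 4 * N1]; by [Hnode] it equals [sqrt (N1 * h)], so
     [offset] is 1 at [j = N1] and at least 1 beyond. *)
  set (T := fun N1 : nat => PI * sqrt 2 * sqrt (INR N1)).
  assert (Hnode : forall j, sqrt (INR j * h) = PI * sqrt 2 * sqrt (INR j)).
  { intros j. pose proof (pos_INR j). unfold h.
    replace (INR j * (2 * PI ^ 2)) with ((PI * PI) * (2 * INR j)) by ring.
    rewrite sqrt_mult, sqrt_square, sqrt_mult by nra. ring. }
  assert (HT4 : forall N1, 4 * T N1 ^ 2 = INR (4 * N1) * h).
  { intros N1. unfold T. rewrite mult_INR.
    replace (4 * (PI * sqrt 2 * sqrt (INR N1)) ^ 2)
      with (4 * (PI * PI) * (sqrt 2 * sqrt 2) * (sqrt (INR N1) * sqrt (INR N1))) by ring.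
    rewrite !sqrt_sqrt by (try apply pos_INR; lra). unfold h. simpl. ring. }
  assert (HT0 : forall N1, 0 <= T N1).
  { intros N1. pose proof (sqrt_pos 2). pose proof (sqrt_pos (INR N1)). unfold T.
    apply Rmult_le_pos; [nra | assumption]. }
  assert (Hdeg : forall N1, (1 <= N1)%nat -> INR (S (taylor_deg N1)) <= 12 * sqrt (INR N1)).
  { intros N1 H1. rewrite S_INR. pose proof (taylor_deg_bounds N1).
    assert (1 <= sqrt (INR N1)) by (rewrite <- sqrt_1; apply sqrt_le_1_alt; apply le_INR in H1; exact H1).
    lra. }
  exists (fun N1 => S (taylor_deg N1)), (fun N1 j => amp (T N1) h j * pole N1 j),
    (fun N1 => poly_coef (T N1) h N1 (taylor_deg N1) (4 * N1)).
  split; [exists 12, 1%nat; exact Hdeg|].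
  (* [24 = 23 + 1], the 1 for the Taylor polynomials; [exp (9 * PI)] pays for replacing [N1] by
     [N1 + N2]. [N1 >= M] makes the hypothesis available at [4 * N1]. *)
  exists ((exp 4 + exp 2 + 24) * exp (9 * PI)), (Nat.max 1 M). intros N1 HN1 x Hx.
  assert (HN : (1 <= N1)%nat) by lia. specialize (Hdeg N1 HN).
  pose proof (taylor_deg_bounds N1) as Hk. pose proof sqrt_2_bounds as H2.
  pose proof PI_le_334 as HPu. pose proof (sqrt_pos (INR N1)) as Hr.
  pose proof (exp_pos (- T N1)) as HeT.
  set (k := taylor_deg N1) in *. set (r := sqrt (INR N1)) in *.
  assert (ET : sqrt (INR (4 * N1) * h / 4) = T N1).
  { replace (INR (4 * N1) * h / 4) with (T N1 * T N1) by (pose proof (HT4 N1); nra).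
    apply sqrt_square, HT0. }
  assert (Htrap : Rabs (trap (T N1) h (4 * N1) x - sqrt x) <= (exp 4 + exp 2 + 23) * exp (- T N1)).
  { apply trap_error; [apply HT0 | apply HT4 | exact Hx |]. intros Hxb. fold h.
    pose proof (HM (4 * N1)%nat ltac:(lia) ltac:(lia)) as HG. cbv zeta in HG. fold h in HG.
    rewrite ET in HG. apply HG. lra. }
  assert (Hrt : Rabs (r_fun N1 (S k) (fun j => amp (T N1) h j * pole N1 j)
      (poly_coef (T N1) h N1 k (4 * N1)) x - trap (T N1) h (4 * N1) x) <= (/ 3) ^ k * exp (T N1)).
  { apply r_fun_error; [exact Hh | exact Hx | lia | |].
    (* [sigma] is twice the node spacing factor [PI * sqrt 2], so the prescribed poles are exactly
       those of the sum. *)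
    - intros j. unfold pole, offset. do 2 f_equal. rewrite Hnode. unfold T, Defs.sigma. fold r. ring.
    - intros j Hj. unfold offset. rewrite <- exp_0. apply exp_le_mono. rewrite Hnode. unfold T.
      assert (sqrt (INR N1) <= sqrt (INR j)) by (apply sqrt_le_1_alt, le_INR; lia).
      assert (0 <= PI * sqrt 2) by (apply Rmult_le_pos; lra). nra. }
  assert (Hpow : (/ 3) ^ k * exp (T N1) <= exp (- T N1)).
  { replace (exp (- T N1)) with (exp (- (2 * T N1)) * exp (T N1)) by (rewrite <- exp_plus; f_equal; ring).
    apply Rmult_le_compat_r; [apply Rlt_le, exp_pos|].
    eapply Rle_trans; [apply third_pow_le|]. apply exp_le_mono.
    assert (PI * sqrt 2 <= 5) by nra. unfold T. fold r. nra. }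
  assert (Hfin : exp (- T N1) <= exp (9 * PI) * exp (- PI * sqrt (2 * INR (N1 + S k)))).
  { rewrite <- exp_plus. apply exp_le_mono.
    (* The cross term [18 * sqrt 2 * r] exceeds [24 * r], which is twice the bound [12 * r] on the
       degree. *)
    assert (Hsq : sqrt (2 * INR (N1 + S k)) <= sqrt 2 * r + 9).
    { rewrite <- (sqrt_square (sqrt 2 * r + 9)) by nra. apply sqrt_le_1_alt.
      rewrite plus_INR.
      assert (Hrr : r * r = INR N1) by (apply sqrt_sqrt, pos_INR).
      assert (H22 : sqrt 2 * sqrt 2 = 2) by (apply sqrt_sqrt; lra).
      replace ((sqrt 2 * r + 9) * (sqrt 2 * r + 9))
        with ((sqrt 2 * sqrt 2) * (r * r) + 18 * (sqrt 2 * r) + 81) by ring.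
      rewrite H22, Hrr. nra. }
    unfold T. fold r. nra. }
  eapply Rle_trans.
  { replace (r_fun N1 (S k) (fun j => amp (T N1) h j * pole N1 j)
      (poly_coef (T N1) h N1 k (4 * N1)) x - sqrt x)
    with ((r_fun N1 (S k) (fun j => amp (T N1) h j * pole N1 j)
      (poly_coef (T N1) h N1 k (4 * N1)) x - trap (T N1) h (4 * N1) x)
      + (trap (T N1) h (4 * N1) x - sqrt x)) by ring.
    apply Rabs_triang. }
  apply Rle_trans with ((exp 4 + exp 2 + 24) * exp (- T N1)); [lra|].
  rewrite Rmult_assoc. apply Rmult_le_compat_l; [|exact Hfin].
  pose proof (exp_pos 4). pose proof (exp_pos 2). lra.
Qed.
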